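(* For every positive integer $t$ there is a constant $C_t$ such that for every integer $d\ge 1$ there is an unweighted Gaussian $t$-design in $\mathbb{R}^d$ with at most $C_t\, d^{t-1}$ points.
   Context: Let $\rho$ be the Gaussian probability measure on $\mathbb{R}^d$ given by $d\rho = e^{-\pi|x|^2}\,dx$. An unweighted Gaussian $t$-design in $\mathbb{R}^d$ is a finite nonempty set $X\subset\mathbb{R}^d$ such that $\int_{\mathbb{R}^d} f\,d\rho = \frac{1}{|X|}\sum_{x\in X} f(x)$ for every real polynomial $f$ in $d$ variables of total degree at most $t$. *)

(* Defs.v *)
From HB Require Import structures.
From mathcomp Require Import all_boot all_order all_algebra finmap.
(* [mpoly] comes without its notations, which clash with those of
   mathcomp-analysis, and first, so that it does not shadow the names of
   measure theory. *)
From mathcomp Require Import -(notations) mpoly.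
From mathcomp Require Import all_classical all_reals all_analysis measurable_realfun ring.

Set Implicit Arguments.
Unset Strict Implicit.
Unset Printing Implicit Defensive.

Import Order.TTheory GRing.Theory Num.Theory.
Import numFieldTopology.Exports.

Local Open Scope classical_set_scope.
Local Open Scope ring_scope.

Section lebesgue_tuple.
Context {R : realType}.

Definition cons_pair n (x : measurableTypeR R * n.-tuple R) : n.+1.-tuple R :=
  [tuple of x.1 :: x.2].

Definition uncons_pair n (x : n.+1.-tuple R) : measurableTypeR R * n.-tuple R :=
  (thead x, [tuple of behead x]).

Lemma cons_pairK n : cancel (@cons_pair n) (@uncons_pair n).
Proof. by case=> a x; congr pair; exact/val_inj. Qed.

Lemma uncons_pairK n : cancel (@uncons_pair n) (@cons_pair n).
Proof. by move=> x; rewrite [RHS]tuple_eta. Qed.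

Lemma measurable_cons_pair n : measurable_fun setT (@cons_pair n).
Proof.
by apply: measurable_cons; [exact: measurable_fst|exact: measurable_snd].
Qed.

Lemma measurable_uncons_pair n : measurable_fun setT (@uncons_pair n).
Proof.
apply: measurable_fun_pair; last exact: measurable_behead.
exact: measurable_tnth.
Qed.

(* R^d is [d.-tuple R], with the product sigma-algebra. Its Lebesgue measure is
   built by recursion on d: the product of the measure on R and the one on R^n,
   transported to R^n.+1. *)
Definition lebesgue_cons n
    (mu : {sigma_finite_measure set (n.-tuple R) -> \bar R}) :
    set (n.+1.-tuple R) -> \bar R :=
  pushforward (lebesgue_measure \x mu)%E (@cons_pair n).

Section lebesgue_cons_instance.
Context n (mu : {sigma_finite_measure set (n.-tuple R) -> \bar R}).

Let lebesgue_cons0 : lebesgue_cons mu set0 = 0%E.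
Proof. by rewrite /lebesgue_cons /pushforward preimage_set0 measure0. Qed.

Let lebesgue_cons_ge0 A : (0 <= lebesgue_cons mu A)%E.
Proof. by rewrite /lebesgue_cons /pushforward; exact: measure_ge0. Qed.

Let lebesgue_cons_sigma_additive : semi_sigma_additive (lebesgue_cons mu).
Proof.
exact: (@measure_semi_sigma_additive _ _ _
  (measure_function_pushforward__canonical__measure_function_Measure
    (lebesgue_measure \x mu)%E (@measurable_cons_pair n))).
Qed.

HB.instance Definition _ := isMeasure.Build _ _ _ (lebesgue_cons mu)
  lebesgue_cons0 lebesgue_cons_ge0 lebesgue_cons_sigma_additive.

(* The library's instance for [\x] only covers subprobabilities. *)
Let sigma_finite_lebesgue_cons : sigma_finite setT (lebesgue_cons mu).
Proof.
have /sigma_finiteP[F [FT ndF Foo]] := sigma_finiteT (@lebesgue_measure R).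
have /sigma_finiteP[G [GT ndG Goo]] := sigma_finiteT mu.
exists (fun k => @uncons_pair n @^-1` (F k `*` G k)).
  rewrite -preimage_bigcup [X in _ @^-1` X](_ : _ = setT) ?preimage_setT//.
  apply/esym; rewrite -setXTT FT GT predeqE => -[x y]; split; last first.
    by move=> [k _ []/= ? ?]; split; exists k.
  move=> [/= [i _ Fix] [j _ Gjy]]; exists (maxn i j) => //; split.
    by move: x Fix; exact/subsetPset/ndF/leq_maxl.
  by move: y Gjy; exact/subsetPset/ndG/leq_maxr.
move=> k; have [mF Fk] := Foo k; have [mG Gk] := Goo k; split.
  rewrite -[X in measurable X]setTI.
  by apply: measurable_uncons_pair => //; exact: measurableX.
rewrite /lebesgue_cons /pushforward -comp_preimage.
rewrite (_ : _ \o _ = id); last by rewrite funeqE => x /=; rewrite cons_pairK.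
by rewrite preimage_id product_measure1E// lte_mul_pinfty// ge0_fin_numE.
Qed.

HB.instance Definition _ := @Measure_isSigmaFinite.Build _ _ _
  (lebesgue_cons mu) sigma_finite_lebesgue_cons.
End lebesgue_cons_instance.

Fixpoint lebesgue_tuple n : {sigma_finite_measure set (n.-tuple R) -> \bar R} :=
  match n with
  | 0 => \d_(nil_tuple R)
  | k.+1 => lebesgue_cons (lebesgue_tuple k)
  end.

End lebesgue_tuple.

Section gaussian_measure.
Context {R : realType}.

Definition gaussian_fun d (x : d.-tuple R) : R :=
  expR (- (pi * \sum_(i < d) tnth x i ^+ 2)).

Definition gaussian_measure d : set (d.-tuple R) -> \bar R :=
  fun A => (\int[lebesgue_tuple d]_(x in A) (gaussian_fun x)%:E)%E.

Lemma gaussian_fun_ge0 d (x : d.-tuple R) : 0 <= gaussian_fun x.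
Proof. exact: expR_ge0. Qed.

Lemma measurable_gaussian_fun d :
  measurable_fun [set: d.-tuple R] (@gaussian_fun d).
Proof.
apply: measurableT_comp => //; apply: measurableT_comp => //.
apply: measurable_funM => //; apply: measurable_sum => i.
by apply: measurable_funX; exact: measurable_tnth.
Qed.

Section gaussian_measure_instance.
Context (d : nat).

Let gaussian_measure0 : gaussian_measure (@set0 (d.-tuple R)) = 0%E.
Proof. by rewrite /gaussian_measure integral_set0. Qed.

Let gaussian_measure_ge0 A : (0 <= @gaussian_measure d A)%E.
Proof. by apply: integral_ge0 => x _; rewrite lee_fin gaussian_fun_ge0. Qed.

Let gaussian_measure_sigma_additive : semi_sigma_additive (@gaussian_measure d).
Proof.
move=> F mF tF mUF; rewrite /gaussian_measure ge0_integral_bigcup//=; first 1 last.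
- by apply: measurable_funTS; apply/measurable_EFinP; exact: measurable_gaussian_fun.
- by move=> x _; rewrite lee_fin gaussian_fun_ge0.
apply: is_cvg_ereal_nneg_natsum_cond => k _ _.
by apply: integral_ge0 => x _; rewrite lee_fin gaussian_fun_ge0.
Qed.

HB.instance Definition _ := isMeasure.Build _ _ _ (@gaussian_measure d)
  gaussian_measure0 gaussian_measure_ge0 gaussian_measure_sigma_additive.

End gaussian_measure_instance.

Lemma integral_gaussian1 :
  (\int[@lebesgue_measure R]_x (expR (- (pi * x ^+ 2)))%:E = 1)%E.
Proof.
pose s : R := (Num.sqrt (pi *+ 2))^-1.
have pi2 : 0 < (pi : R) *+ 2 by rewrite pmulrn_lgt0// pi_gt0.
have s0 : s != 0 by rewrite invr_neq0// gt_eqF// sqrtr_gt0.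
have ss : s ^+ 2 = (pi *+ 2)^-1 by rewrite exprVn sqr_sqrtr// ltW.
rewrite -(integral_normal_pdf 0 s); apply: eq_integral => x _.
rewrite normal_pdfE// /normal_peak /normal_fun subr0 ss -mulrnAr.
rewrite mulVf ?gt_eqF// sqrtr1 invr1 mul1r.
congr (expR _)%:E; have := pi_gt0 R; move: (pi : R) => p p0; field; rewrite gt_eqF//.
Qed.

Lemma gaussian_measure_setT d : @gaussian_measure d setT = 1%E.
Proof.
elim: d => [|d IH].
  rewrite /gaussian_measure /= integral_dirac//=; last first.
    by apply/measurable_EFinP; exact: measurable_gaussian_fun.
  by rewrite diracT mul1e /gaussian_fun big_ord0 mulr0 oppr0 expR0.
rewrite /gaussian_measure /= /lebesgue_cons.
rewrite ge0_integral_pushforward//=; first last.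
- by move=> x _; rewrite lee_fin gaussian_fun_ge0.
- by apply/measurable_EFinP; exact: measurable_gaussian_fun.
- exact: measurable_cons_pair.
rewrite preimage_setT fubini_tonelli1//=; first last.
- by move=> x; rewrite lee_fin gaussian_fun_ge0.
- apply/measurable_EFinP; apply: measurableT_comp.
    exact: measurable_gaussian_fun.
  exact: measurable_cons_pair.
rewrite -integral_gaussian1; apply: eq_integral => x _; rewrite /fubini_F.
transitivity (\int[lebesgue_tuple d]_y
    ((expR (- (pi * x ^+ 2)))%:E * (gaussian_fun y)%:E))%E.
  apply: eq_integral => y _; rewrite -EFinM -expRD -opprD -mulrDr.
  rewrite /gaussian_fun big_ord_recl /= tnth0.
  by under eq_bigr do rewrite tnthS.
rewrite ge0_integralZl//=; first last.
- by move=> y _; rewrite lee_fin gaussian_fun_ge0.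
- by apply/measurable_EFinP; exact: measurable_gaussian_fun.
by rewrite [X in (_ * X)%E]IH mule1.
Qed.

HB.instance Definition _ d := @Measure_isProbability.Build _ _ _
  (@gaussian_measure d) (gaussian_measure_setT d).

End gaussian_measure.

(* [mmeasure mdeg f] is one more than the total degree of f (0 for f = 0). *)
Definition gaussian_design (R : realType) (d t : nat) (X : {fset d.-tuple R}) :=
  X != fset0 /\
  forall f : mpoly d R, (mmeasure mdeg f <= t.+1)%N ->
    (\int[@gaussian_measure R d]_x (meval (tnth x) f)%:E =
     ((#|` X|%:R)^-1 * \sum_(x <- X) meval (tnth x) f)%:E)%E.

(* Main.v *)
Require Import Defs.
From HB Require Import structures.
From mathcomp Require Import all_boot all_order all_algebra finmap.
From mathcomp Require Import polyrcf.
From mathcomp Require Import -(notations) mpoly.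
From mathcomp Require Import all_classical all_reals all_analysis.
From mathcomp Require Import measurable_realfun ring lra.

Set Implicit Arguments.
Unset Strict Implicit.
Unset Printing Implicit Defensive.

Import Order.TTheory GRing.Theory Num.Theory.
Import numFieldTopology.Exports numFieldNormedType.Exports.

Local Open Scope ring_scope.

(** The points of the design are the words of a linear code over a finite field
    of prime order [p], read in [R^d] through a labelling of the field by [p]
    real numbers.

    The labels form a Gaussian design of strength [t] on the line with equal
    weights. A monomial of degree at most [t] in [d] variables involves at most
    [t] of them. Hence, if any [t] coordinates of a uniformly random word of the
    code are independent and uniform, then the average of the monomial over the
    code is the product of the averages of powers of one variable over the
    labels ([code_average]). These are Gaussian moments, and the integral of the
    monomial is the same product ([integral_gaussian_measure_monomial]). A code
    with this property and with at most [p * (p d) ^ (t - 1)] words exists by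
    the greedy argument of Gilbert and Varshamov ([exists_independent_rows]):
    the words are the vectors [G w] for a matrix [G] any [t] rows of which are
    independent, and each new row only has to avoid the combinations of [t - 1]
    earlier ones. As [p] depends on [t] alone, [C = p ^ t] is the constant.

    It remains to find, for every large [n], a Gaussian design of strength [t] on
    the line with [n] distinct points and equal weights
    ([equal_weight_design]). Gauss-Hermite quadrature with [t + 1] nodes
    ([gauss_quadrature]) has positive weights [w i]. Placing about [n * w i]
    points near the [i]-th node gives power sums whose error is bounded
    independently of [n]. To remove the error, group some of these points into
    [N] blocks with one point near each node, and move the blocks. A block is the
    root set of a real polynomial of degree [t + 1] with simple roots, and small
    changes of its coefficients keep the roots real and simple
    ([roots_poly_open]). By Newton's identities ([power_sum_perturb]), changing
    the coefficient of degree [t + 1 - j] moves the [j]-th power sum and leaves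
    the lower ones alone, so the first [t] power sums can be corrected one after
    the other ([prescribed_power_sums]); the changes are small when [N] is
    large. The constant coefficient has no influence on the first [t] power sums
    and serves to keep all the points distinct. *)

(** * Polynomials with simple real roots *)

Section split.
Variable R : rcfType.
Implicit Types (P D : {poly R}) (a b y : nat -> R).

Definition roots_poly a m : {poly R} := \prod_(i < m) ('X - (a i)%:P).

Definition strictly_increasing a m := forall i j, (i < j < m)%N -> a i < a j.

Lemma strictly_increasingS a m :
  (forall i, (i.+1 < m)%N -> a i < a i.+1) -> strictly_increasing a m.
Proof.
move=> aS i; elim=> [//|j IH] /andP[]; rewrite ltnS leq_eqVlt.
case/predU1P=> [->|ij] jm; first exact: aS.
by apply: lt_trans (aS _ jm); apply: IH; rewrite ij ltnW.
Qed.

Lemma size_roots_poly a m : size (roots_poly a m) = m.+1.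
Proof. by rewrite /roots_poly size_prod_XsubC /index_enum -enumT size_enum_ord. Qed.

Lemma roots_poly_monic a m : roots_poly a m \is monic.
Proof. exact: monic_prod_XsubC. Qed.

Lemma horner_roots_poly a m x : (roots_poly a m).[x] = \prod_(i < m) (x - a i).
Proof. by rewrite horner_prod; apply: eq_bigr => i _; rewrite hornerXsubC. Qed.

Lemma strictly_increasing_inj a m i j : strictly_increasing a m ->
  (i < m)%N -> (j < m)%N -> a i = a j -> i = j.
Proof.
move=> am im jm aij; case: (ltngtP i j) => // ij.
- by have := am i j; rewrite ij jm aij ltxx => /(_ isT).
- by have := am j i; rewrite ij im aij ltxx => /(_ isT).
Qed.

Lemma uniq_mkseq_increasing a m : strictly_increasing a m -> uniq (mkseq a m).
Proof.
move=> am; rewrite map_inj_in_uniq ?iota_uniq// => i j.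
by rewrite !mem_iota !add0n/=; exact: strictly_increasing_inj.
Qed.

Lemma prod_mkseq a m : \prod_(z <- mkseq a m) ('X - z%:P) = roots_poly a m.
Proof. by rewrite /roots_poly /mkseq big_map -[X in iota 0 X]subn0 big_mkord. Qed.

(** The intermediate value theorem gives one root in each of the [m]
    intervals, and a polynomial of degree [m] has no other. *)
Lemma alternating_roots P m y : P \is monic -> size P = m.+1 ->
  strictly_increasing y m.+1 ->
  (forall i, (i <= m)%N -> 0 < (-1) ^+ (m - i) * P.[y i]) ->
  exists b, [/\ forall i, (i < m)%N -> y i < b i < y i.+1,
    strictly_increasing b m & P = roots_poly b m].
Proof.
move=> monP sP ym sgP.
have ivt i : {x : R | (i < m)%N ==> (y i < x < y i.+1) && root P x}.
  case: (ltnP i m) => im; last by exists 0.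
  have yi : y i <= y i.+1 by apply/ltW/ym; rewrite leqnn ltnS.
  have : P.[y i] * P.[y i.+1] < 0.
    have := mulr_gt0 (sgP _ (ltnW im)) (sgP _ im).
    rewrite subnS -[(m - i)%N]prednK ?subn_gt0//=.
    by rewrite exprS mulrACA -(mulrA (-1)) -expr2 sqrr_sign mulr1 mulN1r oppr_gt0.
  by case/(poly_ivtoo yi) => x; rewrite in_itv/= => yx rx; exists x; rewrite yx rx.
pose b i := sval (ivt i).
have bP i : (i < m)%N -> (y i < b i < y i.+1) && root P (b i).
  by move=> im; have /implyP := svalP (ivt i); exact.
have bm : strictly_increasing b m.
  apply: strictly_increasingS => i im.
  have /andP[/andP[_ bi] _] := bP _ (ltnW im).
  by have /andP[/andP[bi1 _] _] := bP _ im; exact: lt_trans bi bi1.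
exists b; split=> //; first by move=> i /bP/andP[].
rewrite -prod_mkseq -[RHS]scale1r -(monicP monP).
apply: all_roots_prod_XsubC; first by rewrite size_mkseq.
  apply/allP => x /mapP[i]; rewrite mem_iota add0n => /= im ->.
  by have /andP[] := bP _ im.
by rewrite uniq_rootsE uniq_mkseq_increasing.
Qed.

Lemma roots_poly_sign a m i x : (i <= m)%N ->
  (forall k, (k < i)%N -> a k < x) -> (forall k, (i <= k < m)%N -> x < a k) ->
  0 < (-1) ^+ (m - i) * (roots_poly a m).[x].
Proof.
rewrite horner_roots_poly; elim: m => [|m IH].
  by rewrite leqn0 => /eqP-> _ _; rewrite big_ord0 mulr1.
rewrite leq_eqVlt => /predU1P[->|im] ax xa.
  rewrite subnn mul1r big_ord_recr/= mulr_gt0 ?subr_gt0 ?ax//.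
  by apply: prodr_gt0 => k _; rewrite subr_gt0 ax// ltnS ltnW.
rewrite big_ord_recr/= subSn// exprS mulN1r mulNr -mulrN -mulrN mulrA.
rewrite opprB mulr_gt0//; last by rewrite subr_gt0 xa// ltnSn andbT -ltnS.
by apply: IH => // k /andP[ik km]; apply: xa; rewrite ik ltnS ltnW.
Qed.

(** Having [m] simple real roots is an open condition on monic polynomials of
    degree [m]: the signs at points that separate the roots alternate, and a
    perturbation that is small at these points does not change them. *)
Lemma roots_poly_open a m : strictly_increasing a m ->
  exists r M : R, 0 < r /\ 0 < M /\ forall D : {poly R}, (size D <= m)%N ->
    (forall x, `|x| <= M -> `|D.[x]| < r) ->
    exists b, [/\ strictly_increasing b m, forall i, (i < m)%N -> `|b i| <= M &
      roots_poly a m + D = roots_poly b m].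
Proof.
move=> am; pose c := if m is n.+1 then a n + 1 else 0.
(* Midpoints of consecutive roots, and a point beyond each extreme root. *)
pose y i := if i is j.+1 then (if (i < m)%N then (a j + a i) / 2 else c) else a 0%N - 1.
have ya i : (i < m)%N -> y i < a i.
  rewrite /y; case: i => [|i] im; first by rewrite ltrBlDr ltrDl.
  by rewrite im (midf_lt _).2// am// leqnn im.
have ay i : (i < m)%N -> a i < y i.+1.
  move=> im; rewrite /y/=; case: ifP => im'.
    by rewrite (midf_lt _).1// am// leqnn im'.
  have E : m = i.+1 by apply/eqP; rewrite eqn_leq im leqNgt im'.
  by rewrite /c E ltrDl.
have ym : strictly_increasing y m.+1.
  by apply: strictly_increasingS => i; rewrite ltnS => im; rewrite (lt_trans (ya _ im)) ?ay.
have sgA i : (i <= m)%N -> 0 < (-1) ^+ (m - i) * (roots_poly a m).[y i].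
  move=> im; apply: roots_poly_sign => // k.
    move=> ki; apply: lt_le_trans (ay _ (leq_trans ki im)) _.
    move: ki; rewrite leq_eqVlt => /predU1P[->//|ki].
    by apply/ltW/ym; rewrite ki.
  move=> /andP[ik km]; apply: (le_lt_trans _ (ya _ km)).
  move: ik; rewrite leq_eqVlt => /predU1P[->//|ik].
  by apply/ltW/ym; rewrite ik ltnS ltnW.
have [r r0 rA] : exists2 r : R, 0 < r & forall i, (i <= m)%N -> r <= `|(roots_poly a m).[y i]|.
  exists (\big[Num.min/1]_(i < m.+1) `|(roots_poly a m).[y i]|).
    apply: (@big_rec _ (fun x => 0 < x)) => // i x _ x0; rewrite lt_min x0 andbT normr_gt0.
    have /sgA : (i <= m)%N by rewrite -ltnS.
    by apply: contraTneq => ->; rewrite mulr0 ltxx.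
  move=> i im.
  exact: (bigmin_le _ (Ordinal (im : (i < m.+1)%N))).
exists r, (1 + \sum_(i < m.+1) `|y i|); do 2 split=> //.
  by rewrite ltr_pwDl// sumr_ge0.
move=> D sD rD; have yM i : (i <= m)%N -> `|y i| <= 1 + \sum_(i < m.+1) `|y i|.
  move=> im; rewrite (bigD1 (Ordinal (im : (i < m.+1)%N)))//= addrCA lerDl.
  by rewrite addr_ge0 ?sumr_ge0.
have sD' : (size D < size (roots_poly a m))%N by rewrite size_roots_poly ltnS.
have [b [yb bm Eb]] : exists b, [/\ forall i, (i < m)%N -> y i < b i < y i.+1,
    strictly_increasing b m & roots_poly a m + D = roots_poly b m].
  apply: alternating_roots => //.
  - by rewrite monicE lead_coefDl// -monicE roots_poly_monic.
  - by rewrite size_polyDl// size_roots_poly.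
  - move=> i im; rewrite hornerD mulrDr.
    have := rD _ (yM _ im); have := rA _ im; have := sgA _ im.
    set A := (roots_poly a m).[_]; set d := D.[_] => sA rA' dr.
    have -> : (-1) ^+ (m - i) * A = `|A|.
      by rewrite -(gtr0_norm sA) normrM normrX normrN1 expr1n mul1r.
    have : - ((-1) ^+ (m - i) * d) <= `|d|.
      rewrite (le_trans (ler_norm _))// normrN normrM normrX normrN1.
      by rewrite expr1n mul1r.
    lra.
exists b; split=> // i im; have /andP[b1 b2] := yb _ im.
have := yM _ (ltnW im); have := yM _ im; rewrite !ler_norml => /andP[_ h1] /andP[h2 _].
by apply/andP; split; [exact: le_trans h2 (ltW b1)|exact: le_trans (ltW b2) h1].
Qed.

End split.

(** * Newton's identities *)

Section newton.
Variable R : rcfType.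
Implicit Types (P D : {poly R}) (a b y : nat -> R) (m k : nat).

Definition power_sum b m k : R := \sum_(i < m) b i ^+ k.

Lemma deriv_roots_poly b m : exists Q : nat -> {poly R},
  (forall i, (i < m)%N -> roots_poly b m = Q i * ('X - (b i)%:P)) /\
  (roots_poly b m)^`() = \sum_(i < m) Q i.
Proof.
elim: m => [|m [Q [QE dE]]].
  by exists (fun=> 0); split=> //; rewrite /roots_poly !big_ord0 derivC.
exists (fun i => if (i < m)%N then Q i * ('X - (b m)%:P) else roots_poly b m).
have bS : roots_poly b m.+1 = roots_poly b m * ('X - (b m)%:P).
  by rewrite /roots_poly big_ord_recr.
split=> [i|].
  rewrite ltnS leq_eqVlt bS => /predU1P[->|im]; first by rewrite ltnn.
  by rewrite im (QE _ im) mulrAC.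
rewrite bS derivM dE derivXsubC mulr1 big_ord_recr/= ltnn mulr_suml.
by congr (_ + _); apply: eq_bigr => i _; rewrite ltn_ord.
Qed.

(** Synthetic division: the coefficients of the quotient of a polynomial by
    ['X - x] are obtained from the top one downwards by Horner's rule. *)
Lemma coef_div_XsubC (Q : {poly R}) m x k : (size Q <= m)%N -> (k < m)%N ->
  Q`_(m.-1 - k) = \sum_(i < k.+1) (Q * ('X - x%:P))`_(m - (k - i)) * x ^+ i.
Proof.
move=> sQ; elim: k => [|k IH] km.
  rewrite big_ord1 mulr1 !subn0 mulrBr coefB coefMX coefMC.
  by rewrite (nth_default 0 sQ) mul0r subr0; case: m km {sQ}.
rewrite big_ord_recl mulr1 subn0.
have -> : \sum_(i < k.+1) (Q * ('X - x%:P))`_(m - (k.+1 - lift ord0 i)) * x ^+ lift ord0 i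
   = x * Q`_(m.-1 - k).
  rewrite IH; last exact: ltnW.
  rewrite mulr_sumr; apply: eq_bigr => i _.
  by rewrite lift0 subSS exprS; exact: mulrCA.
rewrite mulrBr coefB coefMX coefMC.
have -> : (m - k.+1 == 0)%N = false by apply/negbTE; rewrite subn_eq0 -ltnNge.
have -> : (m.-1 - k)%N = (m - k.+1)%N by rewrite -subn1 -subnDA add1n.
by rewrite mulrC subrK -subn1 -subnDA add1n subnS.
Qed.

(** Newton's identities, with coefficients counted from the leading one. The
    coefficients of [P'], which is the sum of the quotients [P / ('X - b i)],
    are computed by synthetic division of each quotient. *)
Lemma newton b m k : (k < m)%N ->
  \sum_(i < k.+1) (roots_poly b m)`_(m - (k - i)) * power_sum b m i =
  (roots_poly b m)`_(m - k) *+ (m - k).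
Proof.
move=> km; have [Q [QE dE]] := deriv_roots_poly b m.
have -> : (m - k)%N = (m.-1 - k).+1 by rewrite -subSn ?prednK// ?(leq_trans _ km)// -ltnS prednK ?(leq_trans _ km).
rewrite -coef_deriv dE coef_sum.
transitivity (\sum_(j < m) \sum_(i < k.+1) (roots_poly b m)`_(m - (k - i)) * b j ^+ i).
  rewrite exchange_big/=; apply: eq_bigr => i _.
  by rewrite mulr_sumr.
apply: eq_bigr => j _; rewrite (QE j (ltn_ord j)) -coef_div_XsubC//.
have := size_roots_poly b m; rewrite (QE j (ltn_ord j)).
case: (eqVneq (Q j) 0) => [->|Q0]; first by rewrite size_poly0.
by rewrite size_Mmonic ?monicXsubC// size_XsubC addn2/= => -[->].
Qed.

(** The [k]-th identity determines the [k]-th power sum from the coefficients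
    of degree at least [m - k], and the one of degree [m - k] enters linearly,
    with coefficient [- k]. *)
Lemma power_sum_perturb a b m j D : (0 < j < m)%N -> (size D <= (m - j).+1)%N ->
  roots_poly b m = roots_poly a m + D ->
  (forall i, (i < j)%N -> power_sum b m i = power_sum a m i) /\
  power_sum b m j = power_sum a m j - D`_(m - j) *+ j.
Proof.
move=> /andP[j0 jm] sD E.
have lead c : (roots_poly c m)`_m = 1 :> R.
  by have := roots_poly_monic c m; rewrite monicE lead_coefE size_roots_poly => /eqP.
have rec c k : (k < m)%N -> power_sum c m k = (roots_poly c m)`_(m - k) *+ (m - k) -
   \sum_(i < k) (roots_poly c m)`_(m - (k - i)) * power_sum c m i.
  by move=> km; rewrite -newton// big_ord_recr/= subnn subn0 lead mul1r addrAC subrr add0r.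
have Ecoef i : (i < j)%N -> (roots_poly b m)`_(m - i) = (roots_poly a m)`_(m - i).
  move=> ij; rewrite E coefD [D`_ _]nth_default ?addr0// (leq_trans sD)//.
  by rewrite ltn_sub2l// (leq_trans ij)// ltnW.
have eqj i : (i < j)%N -> power_sum b m i = power_sum a m i.
  elim/ltn_ind: i => i IH ij; rewrite !rec ?(ltn_trans ij)//.
  rewrite Ecoef//; congr (_ - _); apply: eq_bigr => k _.
  by rewrite IH ?Ecoef ?(leq_ltn_trans (leq_subr _ _) ij)// (ltn_trans _ ij).
split=> //; rewrite (rec b j)// (rec a j)// E coefD mulrnDl.
have -> : \sum_(i < j) (roots_poly a m + D)`_(m - (j - i)) * power_sum b m i =
  \sum_(i < j) (roots_poly a m)`_(m - (j - i)) * power_sum a m i + D`_(m - j) *+ m.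
  case: j j0 jm sD E Ecoef eqj => // j _ jm sD E Ecoef eqj.
  rewrite big_ord_recl [in RHS]big_ord_recl !subn0 eqj// -E.
  have -> : power_sum a m 0 = m%:R.
    by rewrite /power_sum; under eq_bigr do rewrite expr0; rewrite sumr_const card_ord.
  have -> : \sum_(i < j) (roots_poly b m)`_(m - (j.+1 - lift ord0 i)) *
        power_sum b m (lift ord0 i) =
      \sum_(i < j) (roots_poly a m)`_(m - (j.+1 - lift ord0 i)) *
        power_sum a m (lift ord0 i).
    apply: eq_bigr => i _; rewrite lift0 subSS eqj ?ltnS//.
    by rewrite Ecoef// ltnS leq_subr.
  by rewrite E coefD mulrDl mulr_natr (mulr_natr D`_ _) addrAC.
have -> : D`_(m - j) *+ m = D`_(m - j) *+ (m - j) + D`_(m - j) *+ j.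
  by rewrite -mulrnDr subnK// ltnW.
rewrite opprD !addrA; ring.
Qed.
End newton.

(** * Prescribing power sums of distinct reals *)

Section blocks.
Variable R : archiRcfType.
Implicit Types (a b e : nat -> R) (m k j N : nat) (Z s : seq R).

Lemma pos_avoiding Z (r : R) : 0 < r -> exists2 u, 0 < u <= r & u \notin Z.
Proof.
move=> r0; suff [u ur uZ] : exists2 u, 0 < u <= r & all (fun z => (z <= 0) || (u < z)) Z.
  exists u => //; apply/negP => /(allP uZ); rewrite ltxx orbF leNgt.
  by case/andP: ur => ->.
elim: Z => [|z Z [u /andP[u0 ur] uZ]]; first by exists r; rewrite ?r0/=.
case: (leP z 0) => z0; first by exists u; rewrite /= ?z0 ?u0.
exists (Num.min u (z / 2)).
  by rewrite lt_min u0 divr_gt0//= ge_min ur.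
rewrite /= gt_min ltr_pdivrMr// ltr_pMr// ltr1n !orbT/=.
by apply: sub_all uZ => y /orP[->//|uy]; rewrite gt_min uy orbT.
Qed.

Definition seq_power_sum s k : R := \sum_(x <- s) x ^+ k.

(** Two parameters move the roots of one polynomial: [c] sets the [j]-th power
    sum without touching the lower ones, and the constant term [u] affects no
    power sum up to the [j]-th, which leaves it free for avoiding collisions. *)
Lemma roots_poly_perturb a m j : strictly_increasing a m -> (0 < j < m)%N ->
  exists r M : R, 0 < r /\ forall c u, `|c| <= r -> `|u| <= r ->
    exists b, [/\ strictly_increasing b m, forall i, (i < m)%N -> `|b i| <= M,
      roots_poly b m = roots_poly a m + (c *: 'X^(m - j) + u%:P),
      forall i, (i < j)%N -> power_sum b m i = power_sum a m i &
      power_sum b m j = power_sum a m j - c *+ j].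
Proof.
move=> am jm; have [r [M [r0 [M0 rM]]]] := roots_poly_open am.
have /andP[j0 jm'] := jm.
pose C := M ^+ (m - j) + 1.
have C0 : 0 < C by rewrite ltr_wpDl// exprn_ge0 ?ltW.
exists (r / (2 * C)), M; split; first by rewrite divr_gt0// mulr_gt0.
move=> c u cr ur; pose D := c *: 'X^(m - j) + u%:P.
have sD : (size D <= (m - j).+1)%N.
  rewrite (leq_trans (size_polyD _ _))// geq_max (leq_trans (size_scale_leq _ _)) ?size_polyXn//.
  by rewrite (leq_trans (size_polyC_leq1 _)).
have [] := rM D.
- by rewrite (leq_trans sD)// ltn_subrL j0 (leq_trans _ jm').
- move=> x xM; rewrite hornerD hornerZ hornerXn hornerC.
  apply: (@le_lt_trans _ _ (r / 2)); last by rewrite ltr_pdivrMr// ltr_pMr// ltr1n.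
  rewrite (le_trans (ler_normD _ _))// normrM normrX.
  have -> : r / 2 = r / (2 * C) * M ^+ (m - j) + r / (2 * C).
    by rewrite -[X in _ + X]mulr1 -mulrDr -/C; field; lra.
  by apply: lerD => //; apply: ler_pM => //; rewrite ?exprn_ge0// lerXn2r ?nnegrE// ltW.
move=> b [bm bM Eb]; exists b; split=> //.
- by apply: (proj1 (power_sum_perturb jm sD _)).
- have [_ ->//] := power_sum_perturb jm sD (esym Eb).
  by rewrite coefD coefZ coefXn eqxx mulr1 coefC subn_eq0 leqNgt jm' addr0.
Qed.

Lemma seq_power_sum_mkseq b m k : seq_power_sum (mkseq b m) k = power_sum b m k.
Proof. by rewrite /seq_power_sum /mkseq big_map -[X in iota 0 X]subn0 big_mkord. Qed.

Lemma seq_power_sum_cat s s' k :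
  seq_power_sum (s ++ s') k = seq_power_sum s k + seq_power_sum s' k.
Proof. exact: big_cat. Qed.

Lemma uniq_cat_avoiding Z s s' : uniq s -> {in s, forall x, x \notin Z} ->
  uniq s' -> {in s', forall x, x \notin s ++ Z} ->
  uniq (s ++ s') /\ {in s ++ s', forall x, x \notin Z}.
Proof.
move=> us sZ us' s'Z; split.
  rewrite cat_uniq us us' andbT/=; apply/hasPn => x /s'Z.
  by rewrite mem_cat negb_or => /andP[].
move=> x; rewrite mem_cat => /orP[/sZ//|/s'Z].
by rewrite mem_cat negb_or => /andP[].
Qed.

(** The [j]-th power sum of [N] copies of [a] is shifted by [x] when each copy
    takes the share [x / N]. For [N] large this is a small perturbation, for all
    [x] bounded by [K] at once. The copies differ by their
    constant terms, which makes their roots distinct: two polynomials that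
    differ by a nonzero constant have no common root. The bound [M] on the
    points does not depend on [K], but [N] does. *)
Lemma shift_power_sum a m j : strictly_increasing a m -> (0 < j < m)%N ->
  exists M : R, 0 <= M /\ forall K, exists N, forall x, `|x| <= K -> forall Z,
  exists s, [/\ uniq s /\ {in s, forall x, x \notin Z}, size s = (N * m)%N,
    {in s, forall x, `|x| <= M},
    forall i, (i < j)%N -> seq_power_sum s i = power_sum a m i *+ N &
    seq_power_sum s j = power_sum a m j *+ N + x].
Proof.
move=> am jm; have [r [M [r0 rM]]] := roots_poly_perturb am jm.
have /andP[j0 jm'] := jm.
exists `|M|; split=> // K.
pose N := (Num.truncn (K / r)).+1; exists N => e eK Z.
have rN : K <= r * N%:R.
  by rewrite mulrC -ler_pdivrMr// ltW// truncnS_gt.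
have N0 : (0 < N)%N by [].
(* Each of the N blocks moves its j-th power sum by - c j = e / N. *)
pose c := - e / (N * j)%:R.
have cr : `|c| <= r.
  rewrite /c normrM normfV normr_nat normrN ler_pdivrMr ?ltr0n ?muln_gt0 ?N0//.
  by rewrite (le_trans eK)// (le_trans rN)// ler_pM2l// ler_nat leq_pmulr.
suff [s [sZ ss sM si sj]] : exists s, [/\ uniq s /\ {in s, forall x, x \notin Z},
    size s = (N * m)%N,
    {in s, forall x, `|x| <= `|M|},
    forall i, (i < j)%N -> seq_power_sum s i = power_sum a m i *+ N &
    seq_power_sum s j = (power_sum a m j - c *+ j) *+ N].
  exists s; split=> //; rewrite sj mulrnBl; congr (_ + _).
  rewrite -mulrnA mulnC -mulNrn -(mulr_natr _ (N * j)) /c !mulNr opprK divfK//.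
  by rewrite pnatr_eq0 muln_eq0 negb_or -!lt0n N0.
clearbody c; clear rN N0; clearbody N; elim: N => [|N [s [[us sZ] ss sM si sj]]].
  by exists [::]; split=> // [i _|]; rewrite /seq_power_sum big_nil mulr0n.
pose P := roots_poly a m + c *: 'X^(m - j).
(* A root z of P + u has u = - P(z), so finitely many u are forbidden. *)
have [u /andP[u0 ur] uP] := pos_avoiding [seq - P.[z] | z <- s ++ Z] r0.
have [|b [bm bM bE bi bj]] := rM c u cr _; first by rewrite gtr0_norm.
have root_b x : x \in mkseq b m -> P.[x] = - u.
  move=> /mapP[i]; rewrite mem_iota add0n => /= im ->.
  have : (roots_poly b m).[b i] = 0.
    by rewrite horner_roots_poly (bigD1 (Ordinal im))//= subrr mul0r.
  by rewrite bE addrA -/P hornerD hornerC => /eqP; rewrite addr_eq0 => /eqP.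
exists (s ++ mkseq b m); split.
- apply: uniq_cat_avoiding => //; first exact: uniq_mkseq_increasing.
  move=> x /root_b Px; apply: contra uP => xZ; apply/mapP; exists x => //.
  by rewrite Px opprK.
- by rewrite size_cat ss size_mkseq mulSn addnC.
- move=> x; rewrite mem_cat => /orP[/sM//|/mapP[i]]; rewrite mem_iota add0n => /= im ->.
  exact: le_trans (bM _ im) (ler_norm _).
- by move=> i ij; rewrite seq_power_sum_cat si// seq_power_sum_mkseq bi// -mulrSr.
- by rewrite seq_power_sum_cat sj seq_power_sum_mkseq bj -mulrSr.
Qed.

Lemma seq_power_sum_le s (M : R) k : 0 <= M -> {in s, forall x, `|x| <= M} ->
  `|seq_power_sum s k| <= M ^+ k *+ size s.
Proof.
move=> M0; rewrite /seq_power_sum; elim: s => [|x s IH] sM.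
  by rewrite big_nil normr0.
rewrite big_cons mulrS (le_trans (ler_normD _ _))// lerD//.
  by rewrite normrX lerXn2r ?nnegrE ?sM ?mem_head.
by apply: IH => y ys; apply: sM; rewrite in_cons ys orbT.
Qed.

(** The power sums are corrected one after the other, by increasing index: a
    correction of the [j]-th one leaves the lower ones untouched and spoils the
    higher ones by a bounded amount, which the later corrections take into
    account. The number [N] of blocks is uniform in the errors [e] to be
    absorbed, which is what makes the lemma usable with errors that are bounded
    independently of the total number of points. *)
Lemma prescribed_power_sums a m t : strictly_increasing a m -> (t < m)%N ->
  forall K, exists N, forall e, (forall i, (0 < i <= t)%N -> `|e i| <= K) -> forall Z,
  exists s, [/\ uniq s, {in s, forall x, x \notin Z}, size s = (N * m)%N &
    forall i, (0 < i <= t)%N -> seq_power_sum s i = power_sum a m i *+ N + e i].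
Proof.
move=> am tm K.
suff H k j K' : (j + k = t.+1)%N -> (0 < j)%N -> exists N, forall e,
  (forall i, (j <= i <= t)%N -> `|e i| <= K') -> forall Z,
  exists s, [/\ uniq s, {in s, forall x, x \notin Z}, size s = (N * m)%N &
    forall i, (i <= t)%N ->
      seq_power_sum s i = power_sum a m i *+ N + (if (j <= i)%N then e i else 0)].
  have [N HN] := H t 1 K (add1n t) isT; exists N => e eK Z.
  have [s [us sZ ss si]] := HN e eK Z; exists s; split=> // i /andP[i0 it].
  by rewrite si// i0.
elim: k => [|k IH] in j K' *.
  rewrite addn0 => -> _; exists 0%N => e _ Z; exists [::]; split=> // i it.
  by rewrite /seq_power_sum big_nil mulr0n ltnNge it addr0.
rewrite addnS => -[jk] j0; have jm : (0 < j < m)%N.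
  by rewrite j0 (leq_ltn_trans _ tm)// -jk leq_addr.
have [M [M0 HM]] := shift_power_sum am jm; have [N1 HN1] := HM K'.
(* B i bounds the damage done to the i-th power sum by correcting the j-th. *)
pose B i := (M ^+ i + `|power_sum a m i|) *+ (N1 * m).+1.
have B0 i : 0 <= B i by rewrite mulrn_wge0// addr_ge0// exprn_ge0.
have [|//|N2 HN2] := IH j.+1 (K' + \sum_(i < t.+1) B i); first by rewrite addSn jk.
exists (N1 + N2)%N => e eK Z.
have [|s1 [[us1 s1Z] ss1 s1M s1i s1j]] := HN1 (e j) _ Z.
  by apply: eK; rewrite leqnn -jk leq_addr.
pose d i := seq_power_sum s1 i - power_sum a m i *+ N1.
have dB i : `|d i| <= B i.
  apply: (@le_trans _ _ (M ^+ i *+ (N1 * m) + `|power_sum a m i| *+ N1)); last first.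
    rewrite /B mulrnDl lerD ?ler_wpMn2l ?exprn_ge0//.
    by rewrite leqW// leq_pmulr// (leq_ltn_trans _ tm).
  rewrite (le_trans (ler_normB _ _))// normrMn lerD2r.
  by rewrite -ss1 seq_power_sum_le.
have [|s2 [us2 s2Z ss2 s2i]] := HN2 (fun i => e i - d i) _ (s1 ++ Z).
  move=> i /andP[ji it]; rewrite (le_trans (ler_normB _ _))// lerD//.
    by rewrite eK// (ltnW ji).
  rewrite (le_trans (dB i))// (bigD1 (Ordinal (it : (i < t.+1)%N)))//=.
  by rewrite lerDl sumr_ge0.
have [us sZ] := uniq_cat_avoiding us1 s1Z us2 s2Z.
exists (s1 ++ s2); split=> //; first by rewrite size_cat ss1 ss2 mulnDl.
move=> i it; rewrite seq_power_sum_cat s2i// mulrnDr -addrA.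
case: (ltngtP j i) => [ji|ij|ij]; rewrite /d.
- ring.
- by rewrite s1i// addr0.
- by rewrite -ij s1j; ring.
Qed.
End blocks.

(** * Gauss-Hermite quadrature *)

Section hermite.
Variables (R : rcfType) (v : R).
Hypothesis v0 : 0 < v.
Implicit Types (p q : {poly R}).

(** The moments of the centred normal law of variance [v]. *)
Fixpoint gaussian_moment k : R :=
  match k with
  | 0 => 1
  | 1 => 0
  | (k'.+1 as l).+1 => v * l%:R * gaussian_moment k'
  end.

Definition gaussian_mean p : R := \sum_(i < size p) p`_i * gaussian_moment i.

Lemma gaussian_meanE n p : (size p <= n)%N ->
  gaussian_mean p = \sum_(i < n) p`_i * gaussian_moment i.
Proof.
move=> pn; rewrite /gaussian_mean -!(big_mkord predT (fun i => p`_i * gaussian_moment i)).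
rewrite (big_cat_nat (leq0n _) pn)//= [X in _ = _ + X]big_nat.
rewrite [X in _ = _ + X]big1 ?addr0// => i /andP[ip _].
by rewrite nth_default// mul0r.
Qed.

Lemma gaussian_mean_is_linear : scalar gaussian_mean.
Proof.
move=> c p q; pose n := (size p + size q)%N.
rewrite !(@gaussian_meanE n) ?leq_addr ?leq_addl//; last first.
  rewrite (leq_trans (size_polyD _ _))// geq_max leq_addl andbT.
  by rewrite (leq_trans (size_scale_leq _ _))// leq_addr.
rewrite mulr_sumr -big_split/=; apply: eq_bigr => i _.
by rewrite coefD coefZ mulrDl mulrA.
Qed.

HB.instance Definition _ :=
  GRing.isLinear.Build R {poly R} R *%R gaussian_mean gaussian_mean_is_linear.

Lemma gaussian_mean_Xn k : gaussian_mean 'X^k = gaussian_moment k.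
Proof.
rewrite /gaussian_mean size_polyXn big_ord_recr/= coefXn eqxx mul1r big1 ?add0r// => i _.
by rewrite coefXn ltn_eqF ?mul0r.
Qed.

(** Gaussian integration by parts. *)
Lemma gaussian_mean_XM p : gaussian_mean ('X * p) = v * gaussian_mean p^`().
Proof.
rewrite -[p]coefK poly_def mulr_sumr !linear_sum mulr_sumr; apply: eq_bigr => i _.
rewrite /= -scalerAr derivZ -exprS !linearZ/= mulrCA; congr (_ * _).
rewrite gaussian_mean_Xn derivXn linearMn/= gaussian_mean_Xn.
case: (i : nat) => [|k]; first by rewrite mulr0n mulr0.
by rewrite /= -mulrA mulr_natl.
Qed.

(** The monic Hermite polynomials for the variance [v], generated by the operator
    ['X - v d/dX], the adjoint of [v d/dX] with respect to [gaussian_mean]. *)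
Fixpoint hermite k : {poly R} :=
  if k is l.+1 then 'X * hermite l - v *: (hermite l)^`() else 1.

Lemma hermite_monic_size k : hermite k \is monic /\ size (hermite k) = k.+1.
Proof.
elim: k => [|k [monH sH]]; first by rewrite monic1 size_poly1.
have s1 : size ('X * hermite k) = k.+2.
  by rewrite mulrC size_mulX ?sH// -size_poly_eq0 sH.
have s2 : (size (- (v *: (hermite k)^`()))%R < size ('X * hermite k)%R)%N.
  rewrite size_polyN s1 (leq_ltn_trans (size_scale_leq _ _))//.
  rewrite (leq_ltn_trans (_ : _ <= k.+1)%N)// -sH ltnW// lt_size_deriv//.
  by rewrite -size_poly_eq0 sH.
split; last by rewrite /= size_polyDl// s1.
by rewrite /= monicE lead_coefDl// -monicE monicMl// monicX.
Qed.

(** Rodrigues' formula, in integrated form. It contains the orthogonality of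
    [hermite k] to all polynomials of degree less than [k]. *)
Lemma gaussian_mean_hermiteM k p :
  gaussian_mean (hermite k * p) = v ^+ k * gaussian_mean p^`(k).
Proof.
elim: k p => [|k IH] p; first by rewrite !mul1r.
rewrite /= mulrBl linearB/= -mulrA gaussian_mean_XM derivM.
rewrite -scalerAl linearZ linearD/= mulrDr addrAC subrr add0r IH.
by rewrite exprS mulrA -derivSn.
Qed.

(** By induction on the degree: [p] is the sum of a multiple of a Hermite
    polynomial and of a polynomial of smaller degree orthogonal to it. *)
Lemma gaussian_mean_sqr_gt0 p : p != 0 -> 0 < gaussian_mean (p ^+ 2).
Proof.
have [n] := ubnP (size p); elim: n => // n IH in p *; rewrite ltnS => pn p0.
have [monH sH] := hermite_monic_size (size p).-1.
have sp : (size p).-1.+1 = size p by rewrite prednK// size_poly_gt0.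
set H := hermite _ in monH sH; set c := lead_coef p; pose g := p - c *: H.
have c0 : c != 0 by rewrite lead_coef_eq0.
have sg : (size g <= (size p).-1)%N.
  have gp : (size g <= (size p).-1.+1)%N.
    rewrite (leq_trans (size_polyD _ _))// size_polyN geq_max sp leqnn.
    by rewrite (leq_trans (size_scale_leq _ _))// sH sp.
  apply/leq_sizeP => j; rewrite leq_eqVlt => /predU1P[<-|jp]; last first.
    by rewrite nth_default// (leq_trans gp).
  rewrite coefB coefZ -/(lead_coef p) -/c.
  move: monH; rewrite monicE lead_coefE sH/= => /eqP->.
  by rewrite mulr1 subrr.
have g2 : 0 <= gaussian_mean (g ^+ 2).
  case: (eqVneq g 0) => [->|g0]; first by rewrite expr0n linear0.
  by rewrite ltW// IH// (leq_ltn_trans sg)// -ltnS sp.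
have HH : gaussian_mean (H * H) = v ^+ (size p).-1 * ((size p).-1`!)%:R.
  rewrite gaussian_mean_hermiteM; congr (_ * _).
  rewrite [H^`(_)](_ : _ = (((size p).-1)`!)%:R%:P).
    by rewrite -(mulr1 _%:P) mul_polyC linearZ/= -(expr0 'X) gaussian_mean_Xn mulr1.
  apply/polyP => i; rewrite coef_derivn coefC.
  move: monH; rewrite monicE lead_coefE sH/= => /eqP H1.
  case: i => [|i]; first by rewrite addn0 H1 ffactnn.
  by rewrite nth_default ?mul0rn// sH addnS ltnS leq_addr.
have Hg : gaussian_mean (H * g) = 0.
  by rewrite gaussian_mean_hermiteM derivn_poly0// linear0 mulr0.
have -> : p ^+ 2 = c ^+ 2 *: (H * H) + (c *+ 2) *: (H * g) + g ^+ 2.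
  have -> : p = c *: H + g by rewrite /g addrC subrK.
  rewrite -!mul_polyC; move: (c) => d; rewrite polyCMn polyC_exp; ring.
rewrite !linearD !linearZ/= HH Hg mulr0 addr0 ltr_wpDr//.
apply: mulr_gt0; first by rewrite exprn_even_gt0.
by rewrite mulr_gt0 ?exprn_gt0 ?ltr0n ?fact_gt0.
Qed.

Lemma monic_pos_above p B : p \is monic -> exists2 U, B < U & 0 < p.[U].
Proof.
move=> monp; have [|n Hn] := @poly_pinfty_gt_lc _ p; first by rewrite (monicP monp).
exists (Num.max (B + 1) n); first by rewrite lt_max ltrDl ltr01.
by apply: lt_le_trans (Hn _ _); rewrite ?(monicP monp)// le_max lexx orbT.
Qed.

Lemma monic_sign_below p B : p \is monic ->
  exists2 L, L < B & 0 < (-1) ^+ (size p).-1 * p.[L].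
Proof.
move=> monp; pose e : R := (-1) ^+ (size p).-1.
have [|U BU pU] := @monic_pos_above (e *: (p \Po (- 'X))) (- B).
  rewrite monicE lead_coefZ lead_coef_comp ?size_polyN ?size_polyX//.
  by rewrite lead_coefN lead_coefX (monicP monp) mul1r -expr2 sqrr_sign.
exists (- U); first by rewrite ltrNl.
by move: pU; rewrite hornerZ horner_comp hornerN hornerX.
Qed.

Lemma roots_polyS (a : nat -> R) m i : (i <= m)%N ->
  roots_poly a m.+1 = ('X - (a i)%:P) * roots_poly (a \o bump i) m.
Proof.
move=> im; pose i' := Ordinal (im : (i < m.+1)%N).
by rewrite /roots_poly (bigD1_ord i').
Qed.

(** At a root of [hermite k] the recurrence reduces [hermite k.+1] to
    [- v] times the derivative of [hermite k], whose signs alternate along the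
    simple roots; with the signs at infinity, this gives the alternation that
    [alternating_roots] asks for. *)
Lemma hermite_roots k : exists a, strictly_increasing a k /\ hermite k = roots_poly a k.
Proof.
elim: k => [|k [a [ak Ek]]].
  by exists (fun=> 0); split=> [i j|]; rewrite ?ltn0 ?andbF// /roots_poly big_ord0.
have [monH sH] := hermite_monic_size k.+1.
have [U aU HU] := monic_pos_above (Num.max 0 (a k.-1)) monH.
have [L La HL] := monic_sign_below (Num.min 0 (a 0%N)) monH.
pose y i := if i is j.+1 then (if (j < k)%N then a j else U) else L.
have yk : strictly_increasing y k.+2.
  apply: strictly_increasingS => -[|i]; rewrite !ltnS /y => ik.
    case: ifP => _; move: La aU; rewrite lt_min gt_max => /andP[L0 La] /andP[U0 _] //.
    exact: lt_trans L0 U0.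
  rewrite ik; case: ifP => ik'; first by rewrite ak// leqnn ik'.
  have -> : i = k.-1 by apply/eqP; rewrite -eqSS prednK ?(leq_trans _ ik)// eqn_leq ik leqNgt ik'.
  by move: aU; rewrite gt_max => /andP[].
have [|b [_ bk Eb]] := alternating_roots monH sH yk; last by exists b.
case=> [_|i]; first by rewrite subn0; move: HL; rewrite sH.
rewrite ltnS subSS => ik.
move: ik; rewrite leq_eqVlt => /predU1P[->|ik].
  by rewrite subnn mul1r /y ltnn.
rewrite /y ik.
case: k ik ak Ek {monH sH U aU HU L La HL y yk} => // k ik ak Ek.
have EH : (hermite k.+1).[a i] = 0.
  by rewrite Ek (roots_polyS _ (ik : (i <= k)%N)) hornerM hornerXsubC subrr mul0r.
have EH' : (hermite k.+1)^`().[a i] = (roots_poly (a \o bump i) k).[a i].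
  rewrite Ek (roots_polyS _ (ik : (i <= k)%N)) derivM derivXsubC mul1r hornerD.
  by rewrite hornerM hornerXsubC subrr mul0r addr0.
rewrite [hermite k.+2]/= -/(hermite k.+1) hornerD hornerM EH mulr0 add0r.
rewrite hornerN hornerZ EH' subSn// exprS mulN1r mulNr mulrN opprK mulrCA.
rewrite mulr_gt0// roots_poly_sign// => j.
  by move=> ji; rewrite /= /bump leqNgt ji add0n ak// ji.
by move=> /andP[ij jk]; rewrite /= /bump ij add1n ak// !ltnS ij jk.
Qed.

Lemma lagrange_interpolation (a : nat -> R) m (f : {poly R}) : strictly_increasing a m ->
  (size f <= m)%N -> forall l : 'I_m -> {poly R},
  (forall i, (size (l i) <= m)%N) ->
  (forall i j : 'I_m, (l i).[a j] = (i == j)%:R) ->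
  f = \sum_(i < m) f.[a i] *: l i.
Proof.
move=> am sf l sl la; apply/eqP; rewrite -subr_eq0; apply/eqP.
apply: (@roots_geq_poly_eq0 _ _ (mkseq a m)).
- apply/allP => x /mapP[j]; rewrite mem_iota add0n => /= jm ->.
  rewrite rootE hornerD hornerN horner_sum (bigD1 (Ordinal jm))//= hornerZ.
  rewrite (la (Ordinal jm) (Ordinal jm)) eqxx mulr1.
  rewrite big1 ?addr0 ?subrr// => i ij.
  by rewrite hornerZ (la i (Ordinal jm)) (negPf ij) mulr0.
- exact: uniq_mkseq_increasing.
- rewrite size_mkseq (leq_trans (size_polyD _ _))// size_polyN geq_max sf.
  rewrite (leq_trans (size_sum _ _ _))//; apply/bigmax_leqP => i _.
  by rewrite (leq_trans (size_scale_leq _ _)).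
Qed.

(** The nodes are the roots of [hermite m], the weights are the means of the
    Lagrange polynomials. Reducing [f] modulo [hermite m] does not change its
    mean, by orthogonality, so the formula is exact up to degree [2 m - 1]; in
    particular it is exact on the square of a Lagrange polynomial, whence the
    positivity of the weights. *)
Lemma gauss_quadrature m : exists a w : nat -> R, [/\ strictly_increasing a m,
  forall i, (i < m)%N -> 0 < w i &
  forall k, (k < m.*2)%N -> \sum_(i < m) w i * a i ^+ k = gaussian_moment k].
Proof.
case: m => [|m]; first by exists (fun=> 0), (fun=> 0); split=> // i j; rewrite ltn0 andbF.
have [a [am EH]] := hermite_roots m.+1.
pose g i := roots_poly (a \o bump i) m.
have inj_a i j := @strictly_increasing_inj _ a m.+1 i j am.
have g0 i : (i < m.+1)%N -> (g i).[a i] != 0.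
  move=> im; rewrite horner_roots_poly; apply/prodf_neq0 => j _ /=.
  rewrite subr_eq0; apply: contraNneq (neq_bump i j) => /inj_a <-//.
  exact: ltn_ord (lift (Ordinal im) j).
pose l (i : 'I_m.+1) : {poly R} := (g i).[a i]^-1 *: g i.
have sl i : (size (l i) <= m.+1)%N.
  by rewrite (leq_trans (size_scale_leq _ _))// size_roots_poly.
have la (i j : 'I_m.+1) : (l i).[a j] = (i == j)%:R.
  rewrite hornerZ; case: eqVneq => [->|ij]; first by rewrite mulVf// g0.
  have [k -> _] := unlift_some ij.
  by rewrite [X in _ * X]horner_roots_poly [X in _ * X](bigD1 k)//= subrr mul0r mulr0.
have Epoly (f : {poly R}) : (size f <= m.+1.*2)%N ->
    gaussian_mean f = \sum_(i < m.+1) f.[a i] * gaussian_mean (l i).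
  move=> sf; pose H := hermite m.+1.
  have [monH sH] := hermite_monic_size m.+1; rewrite -/H in monH sH.
  have rH (i : 'I_m.+1) : H.[a i] = 0.
    by rewrite /H EH horner_roots_poly (bigD1 i)//= subrr mul0r.
  have H0 : H != 0 by apply: monic_neq0.
  rewrite {1}(divp_eq f H) linearD/= mulrC gaussian_mean_hermiteM derivn_poly0; last first.
    by rewrite size_divp// sH leq_subLR addnn.
  rewrite linear0 mulr0 add0r.
  have sm : (size (f %% H)%R <= m.+1)%N.
    by rewrite -ltnS -sH ltn_modp.
  rewrite {1}(lagrange_interpolation am sm sl la) linear_sum; apply: eq_bigr => i _.
  rewrite linearZ/=; congr (_ * _).
  by rewrite {2}(divp_eq f H) hornerD hornerM rH mulr0 add0r.
exists a, (fun i => if insub i is Some j then gaussian_mean (l j) else 0); split=> //.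
  move=> i im; rewrite insubT.
  have -> : gaussian_mean (l (Sub i im)) = gaussian_mean (l (Sub i im) ^+ 2).
    rewrite [RHS]Epoly.
      rewrite (bigD1 (Sub i im : 'I_m.+1))// big1 ?addr0.
        rewrite horner_exp la eqxx expr1n mul1r; exact/esym/addr0.
      by move=> j ji; rewrite horner_exp la eq_sym (negPf ji) expr0n mul0r.
    rewrite (leq_trans (size_polyMleq _ _))// -subn1 leq_subLR.
    by rewrite add1n -addnn leqW// leq_add.
  apply: gaussian_mean_sqr_gt0; apply/eqP => l0.
  by have := la (Sub i im) (Sub i im); rewrite l0 horner0 eqxx => /esym/eqP; rewrite oner_eq0.
move=> k km; rewrite -gaussian_mean_Xn Epoly ?size_polyXn//.
by apply: eq_bigr => i _; rewrite hornerXn mulrC valK.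
Qed.
End hermite.

(** * Equal-weight Gaussian designs on the line *)

Section line.
Variable R : archiRcfType.
Implicit Types (a b e : nat -> R) (m k j N : nat) (Z s : seq R).

Lemma powers_near (x eps : R) t : 0 < eps -> exists2 d, 0 < d &
  forall y, `|y - x| < d -> forall k, (k < t)%N -> `|y ^+ k - x ^+ k| <= eps.
Proof.
move=> eps0; elim: t => [|t [d d0 dP]]; first by exists 1.
have [d' d'0 d'P] := @poly_cont R x 'X^t eps eps0.
exists (Num.min d d'); first by rewrite lt_min d0.
move=> y; rewrite lt_min => /andP[yd yd'] k; rewrite ltnS leq_eqVlt => /predU1P[->|kt].
  by have := d'P _ yd'; rewrite !hornerXn => /ltW.
exact: dP.
Qed.

Lemma distinct_near s t (eps : R) Z : 0 < eps ->
  exists s', [/\ uniq s', {in s', forall x, x \notin Z}, size s' = size s &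
    forall k, (k < t)%N -> `|seq_power_sum s' k - seq_power_sum s k| <= eps].
Proof.
elim: s => [|x s IH] in eps * => eps0.
  by exists [::]; split=> // k _; rewrite subrr normr0 ltW.
have e2 : 0 < eps / 2 by rewrite divr_gt0.
have [s' [us' s'Z ss' s'k]] := IH _ e2.
have [d d0 dP] := powers_near x t e2.
have [|u /andP[u0 ud] uZ] := @pos_avoiding _ [seq z - x | z <- s' ++ Z] (d / 2).
  by rewrite divr_gt0.
have xu : x + u \notin s' ++ Z.
  by apply: contra uZ => xu; apply/mapP; exists (x + u) => //; rewrite addrC addKr.
exists (x + u :: s'); split=> /=.
- by rewrite us' andbT; apply: contra xu; rewrite mem_cat => ->.
- move=> y; rewrite in_cons => /predU1P[->|/s'Z//].
  by apply: contra xu; rewrite mem_cat orbC => ->.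
- by rewrite ss'.
- move=> k kt; rewrite /seq_power_sum !big_cons opprD addrACA.
  rewrite (le_trans (ler_normD _ _))// [leRHS](splitr eps) lerD ?s'k//.
  apply: dP => //; rewrite addrC addKr gtr0_norm//.
  by rewrite (le_lt_trans ud)// ltr_pdivrMr// ltr_pMr// ltr1n.
Qed.

Lemma seq_power_sum_nseq c (x : R) k : seq_power_sum (nseq c x) k = x ^+ k *+ c.
Proof.
rewrite /seq_power_sum; elim: c => [|c IH]; first by rewrite big_nil.
by rewrite big_cons IH mulrS.
Qed.

Lemma seq_power_sum_flatten (f : nat -> seq R) m k :
  seq_power_sum (flatten [seq f i | i <- iota 0 m]) k =
  \sum_(i < m) seq_power_sum (f i) k.
Proof. by rewrite /seq_power_sum big_flatten big_map -[X in iota 0 X]subn0 big_mkord. Qed.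

(** The quadrature formula with [t + 1] nodes has real weights; rounding
    [n * w i] down to [c i] produces an error on each power sum that is bounded
    independently of [n]. So a number [N] of blocks, independent of [n], suffices
    to absorb it, and [N <= c i] for [n] large. The points that belong to no
    block only need to be distinct and close to the nodes. *)
Lemma equal_weight_design (v : R) t : 0 < v ->
  exists n0, forall n, (n0 <= n)%N -> exists s, [/\ uniq s, size s = n &
    forall k, (k <= t)%N -> seq_power_sum s k = gaussian_moment v k *+ n].
Proof.
move=> v0; have [a [w [am w0 wE]]] := gauss_quadrature v0 t.+1; set m := t.+1 in am w0 wE.
pose Ka k := \sum_(i < m) `|a i| ^+ k.
have Ka0 k : 0 <= Ka k by rewrite sumr_ge0// => i _; rewrite exprn_ge0.
have [N HN] := prescribed_power_sums am (ltnSn t) (1 + \sum_(k < t.+1) Ka k).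
(* This sum exceeds each N / w i, which ensures N <= c i below. *)
exists (\sum_(i < m) (Num.truncn (N%:R / w i)).+1)%N => n n0n.
pose c i := Num.truncn (n%:R * w i).
have nw0 i : (i < m)%N -> 0 <= n%:R * w i by move=> im; rewrite mulr_ge0// ltW// w0.
have cN i : (i < m)%N -> (N <= c i)%N.
  move=> im; rewrite truncn_ge_nat ?nw0// -ler_pdivrMr ?w0//.
  have /ltW/le_trans : N%:R / w i < (Num.truncn (N%:R / w i)).+1%:R by rewrite truncnS_gt.
  apply; rewrite ler_nat (leq_trans _ n0n)//.
  by rewrite (bigD1 (Ordinal im))//= leq_addr.
have cle i : (i < m)%N -> (c i)%:R <= n%:R * w i.
  by move=> im; rewrite truncn_le nw0.
have cerr i : (i < m)%N -> `|n%:R * w i - (c i)%:R| <= 1.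
  move=> im; rewrite ger0_norm ?subr_ge0 ?cle//.
  by rewrite lerBlDr ltW// addrC natr1 truncnS_gt.
have sw : \sum_(i < m) w i = 1.
  by rewrite -[RHS](wE 0%N)//; apply: eq_bigr => i _; rewrite expr0 mulr1.
have cn : (\sum_(i < m) c i <= n)%N.
  rewrite -(ler_nat R) natr_sum (_ : n%:R = \sum_(i < m) n%:R * w i).
    by apply: ler_sum => i _; exact/cle/ltn_ord.
  by rewrite -mulr_sumr sw mulr1.
(* Approximate positions of the points outside of the blocks. The rounding
   leaves some points over; put at 0, they do not contribute to the power sums
   of positive index. *)
pose B := flatten [seq nseq (c i - N) (a i) | i <- iota 0 m] ++ nseq (n - \sum_(i < m) c i) 0.
have sB : (N * m + size B = n)%N.
  rewrite size_cat size_nseq size_flatten /shape -map_comp sumnE big_map.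
  rewrite (eq_bigr (fun i => c i - N)%N); last by move=> i _; rewrite /= size_nseq.
  rewrite -[X in iota 0 X]subn0 -/(index_iota 0 m) big_mkord addnA -[RHS](subnKC cn); congr (_ + _)%N.
  rewrite mulnC -{1}(card_ord m) -sum_nat_const -big_split/=.
  by apply: eq_bigr => i _; rewrite subnKC// cN.
have pB k : (0 < k)%N -> seq_power_sum B k = \sum_(i < m) a i ^+ k *+ (c i - N).
  move=> k0; rewrite seq_power_sum_cat seq_power_sum_nseq expr0n gtn_eqF// mul0rn addr0.
  rewrite seq_power_sum_flatten; apply: eq_bigr => i _.
  by rewrite seq_power_sum_nseq.
have [s2 [us2 _ ss2 s2B]] := distinct_near B t.+1 [::] ltr01.
pose e k := gaussian_moment v k *+ n - power_sum a m k *+ N - seq_power_sum s2 k.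
have eE k : (0 < k <= t)%N -> e k = \sum_(i < m) (n%:R * w i - (c i)%:R) * a i ^+ k -
    (seq_power_sum s2 k - seq_power_sum B k).
  move=> /andP[k0 kt]; rewrite /e opprB [in RHS]addrA pB// addrC -[RHS]addrC; congr (_ + _).
  rewrite -wE; last by rewrite doubleS !ltnS (leq_trans kt)// -addnn leqW// leq_addr.
  rewrite -!sumrMnl -sumrN -!big_split/=; apply: eq_bigr => i _.
  rewrite mulrnBr ?cN//; ring.
have [|s1 [us1 s1Z ss1 s1e]] := HN e _ s2.
  move=> k kt; rewrite eE//; rewrite (le_trans (ler_normB _ _))// addrC lerD//.
    by case/andP: kt => _ kt; exact: s2B.
  have /andP[_ kt'] := kt.
  have KaS : Ka k <= \sum_(j < t.+1) Ka j.
    by rewrite (bigD1 (Ordinal (kt' : (k < t.+1)%N)))//= lerDl sumr_ge0.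
  apply: le_trans KaS.
  rewrite (le_trans (ler_norm_sum _ _ _))// ler_sum// => i _.
  by rewrite normrM normrX ler_piMl ?exprn_ge0// cerr.
have usZ : uniq (s1 ++ s2).
  by rewrite cat_uniq us1 us2 andbT/=; apply/hasPn => x xs2; apply: contraL xs2; exact: s1Z.
exists (s1 ++ s2); split=> //; first by rewrite size_cat ss1 ss2.
move=> [_|k kt].
  rewrite /seq_power_sum; under eq_bigr do rewrite expr0.
  by rewrite big_const_seq count_predT size_cat ss1 ss2 sB iter_addr_0.
by rewrite seq_power_sum_cat s1e// /e; ring.
Qed.
End line.

(** * Linear codes in which few coordinates are independent *)

Section code.
Variable F : finFieldType.
Implicit Types (d k r t : nat).

Definition weight d (x : 'rV[F]_d) : nat := (\sum_i (x 0%R i != 0%R))%N.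

(** A word of weight at most [k + 1] is a word of weight at most [k] modified in
    at most one coordinate. *)
Lemma card_weight_le d k :
  (#|[set x : 'rV[F]_d | weight x <= k]| <= (d.+1 * #|F|) ^ k)%N.
Proof.
elim: k => [|k IH].
  apply: (@leq_trans #|[set (0 : 'rV[F]_d)]|); last by rewrite cards1.
  apply/subset_leq_card/fintype.subsetP => x; rewrite !inE leqn0 sum_nat_eq0 => /forallP x0.
  by apply/eqP/rowP => i; rewrite mxE; apply/eqP; have := x0 i; rewrite eqb0 negbK.
pose f (u : 'rV[F]_d * (option 'I_d * F)) : 'rV[F]_d :=
  u.1 + (if u.2.1 is Some i then u.2.2 *: delta_mx 0 i else 0).
pose A := finset.setX [set x : 'rV[F]_d | weight x <= k]%N [set: option 'I_d * F].
rewrite (@leq_trans #|f @: A|)//; last first.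
  rewrite (leq_trans (leq_imset_card _ _))// cardsX expnSr leq_mul//.
  by rewrite cardsT card_prod card_option card_ord.
apply/subset_leq_card/fintype.subsetP => x; rewrite inE leq_eqVlt => /predU1P[xk|xk]; last first.
  by apply/imsetP; exists (x, (None, 0)); rewrite ?inE /f/= ?addr0 ?andbT.
have [i xi] : exists i, x 0 i != 0.
  apply/existsP; move: xk; apply: contra_eqT; rewrite negb_exists => /forallP x0.
  by rewrite /weight big1// => i _; rewrite (negbTE (x0 i)).
apply/imsetP; exists (x - x 0 i *: delta_mx 0 i, (Some i, x 0 i)); last by rewrite /f/= subrK.
rewrite !inE/= andbT; move: xk; rewrite /weight (bigD1 i)//= xi => -[<-].
rewrite (bigD1 i)//= !mxE !eqxx mulr1 subrr eqxx add0n leq_sum// => j ji.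
by rewrite !mxE eqxx/= (negPf ji) mulr0 subr0.
Qed.

(** In terms of codes: the code with parity-check matrix [G^T] has minimum
    distance greater than [t]. *)
Definition independent_rows d r t (G : 'M[F]_(d, r)) :=
  forall x : 'rV[F]_d, (weight x <= t)%N -> x *m G = 0 -> x = 0.

(** The Gilbert-Varshamov bound: rows are added greedily, each one outside of
    the combinations of [t] previous ones, as long as these do not exhaust the
    whole space. *)
Lemma exists_independent_rows d r t : ((d * #|F|) ^ t < #|F| ^ r)%N ->
  exists G : 'M[F]_(d, r), independent_rows t.+1 G.
Proof.
elim: d => [|d IH] dr; first by exists 0 => x _ _; apply/rowP => -[].
have [|G HG] := IH.
  apply: leq_ltn_trans dr; have [->|t0] := posnP t; first by rewrite !expn0.
  by rewrite leq_exp2r// leq_mul2r leqnSn orbT.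
pose S := [set x *m G | x in [set x : 'rV[F]_d | weight x <= t]%N].
have [v vS] : exists v, v \notin S.
  case: (boolP [exists v, v \notin S]) => [/existsP//|]; rewrite negb_exists => /forallP Sfull.
  have : (#|'rV[F]_r| <= #|S|)%N.
    by apply/subset_leq_card/fintype.subsetP => x _; have := Sfull x; rewrite negbK.
  rewrite card_mx mul1n leqNgt (leq_ltn_trans _ dr)//.
  exact: leq_trans (leq_imset_card _ _) (card_weight_le _ _).
exists (col_mx v G) => x.
rewrite -(hsubmxK (x : 'rV[F]_(1 + d))); set c := lsubmx _; set y := rsubmx _.
have -> : weight (row_mx c y) = ((c 0%R 0%R != 0%R) + weight y)%N.
  rewrite /weight (@big_split_ord _ _ _ 1 d)/= big_ord1; congr (_ + _)%N.
    by rewrite row_mxEl ord1.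
  by apply: eq_bigr => i _; rewrite row_mxEr.
rewrite (mul_row_col c y v G) => xt.
case: (eqVneq (c 0 0) 0) xt => [c0|c0]; last first.
  rewrite add1n ltnS => yt cvyG; case/imsetP: vS.
  exists (- (c 0 0)^-1 *: y).
    rewrite inE (leq_trans _ yt)// leq_sum// => i _; rewrite mxE mulf_eq0 negb_or.
    by case: (y 0 i != 0); rewrite ?andbF ?leq_b1.
  have /eqP cv : c 0 0 *: v == - (y *m G).
    by rewrite -addr_eq0 -mul_scalar_mx -mx11_scalar cvyG.
  by rewrite -scalemxAl scaleNr -scalerN -cv scalerA mulVf// scale1r.
rewrite add0n => yt; have -> : c = 0 by rewrite [c]mx11_scalar c0 raddf0.
by rewrite mul0mx add0r => /(HG _ yt) ->; rewrite row_mx0.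
Qed.

(** Row [i] of [G] is not in the span of the other rows with index in [T], so
    some linear form vanishes on these but not on row [i]. *)
Lemma dual_vector d r t (G : 'M[F]_(d, r)) (T : {set 'I_d}) i :
  independent_rows t G -> (#|T| <= t)%N -> i \in T ->
  exists w : 'cV[F]_r, (G *m w) i 0 = 1 /\
    forall j, j \in T -> j != i -> (G *m w) j 0 = 0.
Proof.
move=> indG Tt iT.
pose B : 'M[F]_(d, r) := \matrix_(j, k) (if j \in T :\ i then G j k else 0).
have [/submxP[x xB]|] := boolP (row i G <= B)%MS.
  (* The relation that would express row i through the others in T. *)
pose y : 'rV[F]_d := \row_j ((j == i)%:R - (if j \in T :\ i then x 0 j else 0)).
  have /indG : (weight y <= t)%N.
    rewrite (leq_trans _ Tt)// -sum1_card big_mkcond leq_sum// => j _.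
    rewrite mxE !inE; case: (eqVneq j i) => [->|ji]; first by rewrite iT leq_b1.
    by rewrite sub0r oppr_eq0; case: (j \in T); rewrite /= ?leq_b1 ?eqxx.
  have -> : y *m G = row i G - x *m B.
    apply/rowP => k; rewrite !mxE -[G i k](_ : \sum_j (j == i)%:R * G j k = _).
      rewrite -sumrB; apply: eq_bigr => j _; rewrite !mxE mulrBl; congr (_ - _).
      by case: ifP; rewrite ?mul0r ?mulr0.
    rewrite (bigD1 i)//= eqxx mul1r big1 ?addr0// => j ji.
    by rewrite (negPf ji) mul0r.
  rewrite xB subrr => /(_ erefl)/rowP/(_ i).
  by rewrite !mxE !inE eqxx subr0 => /eqP; rewrite oner_eq0.
rewrite submxE => /rV0Pn[k]; set c := (_ *m _) 0 k => c0.
exists (c^-1 *: col k (cokermx B)); split.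
  rewrite -scalemxAr mxE (_ : _ i 0 = c) ?mulVf//.
  by rewrite /c !mxE; apply: eq_bigr => j _; rewrite !mxE.
move=> j jT ji; rewrite -scalemxAr mxE (_ : _ j 0 = (B *m cokermx B) j k).
  by rewrite mulmx_coker mxE mulr0.
by rewrite !mxE; apply: eq_bigr => l _; rewrite !mxE !inE ji jT.
Qed.

Section average.
Variables (R : fieldType) (d t : nat) (U : {set 'cV[F]_d}).
Hypothesis qR : #|F|%:R != 0 :> R.
Hypothesis closedU : forall u v a, u \in U -> v \in U -> u + a *: v \in U.
Hypothesis dualU : forall (T : {set 'I_d}) i, (#|T| <= t)%N -> i \in T ->
  exists2 v, v \in U & v i 0 = 1 /\ forall j, j \in T -> j != i -> v j 0 = 0.

(** In a uniformly random word of [U], any [t] coordinates are independent and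
    uniform. Translating by the multiples of a word of [U] that is [1] at [i] and
    [0] at the other indices of [T] averages out the coordinate [i]; then [T]
    loses one element. *)
Lemma code_average (f : 'I_d -> F -> R) (T : {set 'I_d}) : (#|T| <= t)%N ->
  \sum_(u in U) \prod_(i in T) f i (u i 0) =
  #|U|%:R * \prod_(i in T) ((\sum_x f i x) / #|F|%:R).
Proof.
have [n] := ubnP #|T|; elim: n => // n IH in T *; rewrite ltnS => Tn Tt.
have [->|[i iT]] := set_0Vmem T.
  rewrite big_set0 mulr1 -sum1_card natr_sum; apply: eq_bigr => u _.
  by rewrite big_set0.
have [v vU [vi vT]] := dualU Tt iT.
have TD : (#|T| = #|T :\ i|.+1)%N by rewrite (cardsD1 i) iT.
pose P (u : 'cV[F]_d) := \prod_(j in T :\ i) f j (u j 0).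
have shift a : \sum_(u in U) \prod_(j in T) f j (u j 0) =
    \sum_(u in U) f i (u i 0 + a) * P u.
  rewrite (reindex_inj (addIr (a *: v)))/=; apply: eq_big => u.
    apply/idP/idP => [uv|uU]; last exact: closedU.
    by rewrite -(addrK (a *: v) u) -scaleNr closedU.
  move=> _; rewrite (big_setD1 i)//= !mxE vi mulr1; congr (_ * _).
  by apply: eq_bigr => j; rewrite !inE => /andP[ji jT]; rewrite !mxE vT// mulr0 addr0.
have sumP : \sum_(u in U) P u =
    #|U|%:R * \prod_(j in T :\ i) ((\sum_x f j x) / #|F|%:R).
  by apply: IH; [rewrite -TD|apply: leq_trans Tt; rewrite TD].
have qE : (\sum_(u in U) \prod_(j in T) f j (u j 0)) * #|F|%:R =
    (\sum_x f i x) * \sum_(u in U) P u.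
  rewrite mulr_natr -sumr_const.
  rewrite (eq_bigr (fun a => \sum_(u in U) f i (u i 0 + a) * P u)); last first.
    by move=> a _; rewrite -shift.
  rewrite exchange_big/= mulr_sumr; apply: eq_bigr => u _.
  by rewrite -mulr_suml [in RHS](reindex_inj (addrI (u i 0))).
apply: (mulIf qR); rewrite qE sumP [in RHS](big_setD1 i)//=.
by rewrite mulrCA -[RHS]mulrA; congr (_ * _); rewrite [RHS]mulrAC divfK.
Qed.
End average.

(** The code is the column space of a matrix given by the Gilbert-Varshamov
    bound, with the smallest width that the bound permits. *)
Lemma exists_code (t d : nat) : (0 < d)%N -> exists U : {set 'cV[F]_d},
  [/\ (#|U| <= #|F| * (d * #|F|) ^ t)%N, 0 \in U,
    forall u v a, u \in U -> v \in U -> u + a *: v \in U &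
    forall (T : {set 'I_d}) i, (#|T| <= t.+1)%N -> i \in T ->
      exists2 v, v \in U & v i 0 = 1 /\ forall j, j \in T -> j != i -> v j 0 = 0].
Proof.
move=> d0; have F1 : (1 < #|F|)%N := card_finNzRing_gt1 F.
have dF : (0 < (d * #|F|) ^ t)%N by rewrite expn_gt0 muln_gt0 d0 (ltnW F1).
set r := (trunc_log #|F| ((d * #|F|) ^ t)).+1.
have /andP[rle rlt] := trunc_log_bounds F1 dF.
have [G HG] := exists_independent_rows rlt.
exists [set G *m w | w in [set: 'cV[F]_r]]; split.
- rewrite (leq_trans (leq_imset_card _ _))// cardsT card_mx muln1 expnS.
  by rewrite leq_mul2l rle orbT.
- by apply/imsetP; exists 0; rewrite ?inE// mulmx0.
- move=> _ _ a /imsetP[w1 _ ->] /imsetP[w2 _ ->]; apply/imsetP.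
  by exists (w1 + a *: w2); rewrite ?inE// mulmxDr scalemxAr.
- move=> T i Tt iT; have [w [wi wT]] := dual_vector HG Tt iT.
  by exists (G *m w) => //; apply/imsetP; exists w; rewrite ?inE.
Qed.
End code.

(** * Gaussian moments on the line *)

Section moments.
Local Open Scope classical_set_scope.
Local Open Scope ring_scope.
Variable R : realType.
Implicit Types (x y : R) (k n : nat).
Notation mu := (@lebesgue_measure R).

Definition gaussian_monomial k x : R := x ^+ k * expR (- (pi * x ^+ 2)).

Lemma integrable_wide_gaussian :
  mu.-integrable setT (fun x => (expR (- (pi / 2 * x ^+ 2)))%:E).
Proof.
have p0 := pi_gt0 R.
pose s : R := (Num.sqrt pi)^-1.
have s0 : s != 0 by rewrite invr_neq0// gt_eqF// sqrtr_gt0.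
have ss : s ^+ 2 = pi^-1 by rewrite exprVn sqr_sqrtr// ltW.
have := integrableZl measurableT (normal_peak s)^-1 (integrable_normal_pdf 0 s).
apply: eq_integrable => // x _.
rewrite normal_pdfE// /normal_fun subr0 ss -EFinM mulrA mulVf ?mul1r ?gt_eqF ?normal_peak_gt0//.
congr (expR _)%:E; move: (pi : R) p0 => p p0; field; rewrite gt_eqF//.
Qed.

(** Half of the exponent absorbs the power of [x]: for [k > 0], [|x|] is at most
    a constant times [1 + c x^2 <= exp (c x^2)], and with [c = pi / (2 k)] the
    [k]-th power of this exponential is [exp (pi x^2 / 2)]. *)
Lemma gaussian_monomial_le k : exists C : R, forall x,
  `|gaussian_monomial k x| <= C * expR (- (pi / 2 * x ^+ 2)).
Proof.
have p0 := pi_gt0 R.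
case: k => [|k].
  exists 1 => x; rewrite /gaussian_monomial !mul1r ger0_norm ?expR_ge0// ler_expR lerN2.
  by rewrite ler_wpM2r ?sqr_ge0//; move: (pi : R) p0 => p p0; lra.
pose c : R := pi / 2 / k.+1%:R; have c0 : 0 < c by rewrite !divr_gt0.
exists ((1 + c^-1) ^+ k.+1) => x.
have xc : `|x| <= (1 + c^-1) * expR (c * x ^+ 2).
  apply: (@le_trans _ _ ((1 + c^-1) * (1 + c * x ^+ 2))); last first.
    by rewrite ler_wpM2l ?expR_ge1Dx// addr_ge0// invr_ge0 ltW.
  have -> : (1 + c^-1) * (1 + c * x ^+ 2) = 1 + c^-1 + c * x ^+ 2 + x ^+ 2.
    by field; rewrite gt_eqF.
  rewrite -(real_normK (num_real x)); set y := `|x|; have y0 : 0 <= y := normr_ge0 x.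
  have : 0 < c^-1 by rewrite invr_gt0.
  have : 0 <= c * y ^+ 2 by rewrite mulr_ge0 ?sqr_ge0 ?ltW.
  nra.
rewrite /gaussian_monomial normrM normrX (ger0_norm (expR_ge0 _)).
have -> : expR (- (pi * x ^+ 2)) = expR (- (pi / 2 * x ^+ 2)) * expR (- (pi / 2 * x ^+ 2)).
  by rewrite -expRD; congr expR; field.
rewrite mulrA ler_wpM2r ?expR_ge0//.
apply: (@le_trans _ _ (((1 + c^-1) * expR (c * x ^+ 2)) ^+ k.+1 * expR (- (pi / 2 * x ^+ 2)))).
  rewrite ler_wpM2r ?expR_ge0// lerXn2r// nnegrE.
  by rewrite mulr_ge0 ?expR_ge0// addr_ge0// invr_ge0 ltW.
rewrite exprMn -expRM_natl -(mulrA (_ ^+ _)) -expRD.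
have -> : k.+1%:R * (c * x ^+ 2) + - (pi / 2 * x ^+ 2) = 0.
  by rewrite mulrA /c [_ * (_ / _)]mulrC divfK ?pnatr_eq0// subrr.
by rewrite expR0 mulr1.
Qed.

Lemma continuous_gaussian_monomial k : continuous (gaussian_monomial k).
Proof.
move=> x; apply: cvgM; first exact: exprn_continuous.
apply: (cvg_comp _ expR); last exact: continuous_expR.
apply: cvgN; apply: cvgM; first exact: cvg_cst.
exact: exprn_continuous.
Qed.

Lemma integrable_gaussian_monomial k :
  mu.-integrable setT (EFin \o gaussian_monomial k).
Proof.
have [C HC] := gaussian_monomial_le k.
apply: le_integrable (integrableZl measurableT C integrable_wide_gaussian) => //.
  apply/measurable_EFinP; apply: continuous_measurable_fun.
  exact: continuous_gaussian_monomial.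
move=> x _ /=; rewrite lee_fin (le_trans (HC x))//.
exact: ler_norm.
Qed.

Lemma is_derive_gaussian_monomial k x : is_derive x 1 (gaussian_monomial k)
  (k%:R * gaussian_monomial k.-1 x - pi *+ 2 * gaussian_monomial k.+1 x).
Proof.
pose p : {poly R} := - (pi *: 'X^2).
have -> : gaussian_monomial k = (horner ('X^k : {poly R}) : R -> R) * (expR \o horner p).
  by apply/funext => y /=; rewrite !fctE /p !hornerE /gaussian_monomial/= expr2 mulrA.
have E0 : p.[x] = - (pi * x ^+ 2) by rewrite hornerN hornerZ hornerXn.
have E1 : (poly.deriv p).[x] = - (pi * (x *+ 2)).
  by rewrite poly.derivN poly.derivZ poly.derivXn hornerN hornerZ hornerMn hornerXn expr1.
have E2 : (poly.deriv 'X^k).[x] = x ^+ k.-1 *+ k.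
  by rewrite poly.derivXn hornerMn hornerXn.
have D1 := is_derive_poly ('X^k : {poly R}) x.
have D2 : is_derive x 1 (expR \o horner p) (expR p.[x] * (poly.deriv p).[x]).
  exact: is_derive1_comp.
apply: is_derive_eq (is_deriveM D1 D2) _.
rewrite [(_ \o _) x]/= E0 E1 E2 hornerXn /gaussian_monomial /GRing.scale [LHS]/=.
by rewrite -(mulr_natl (x ^+ k.-1)) !exprS; set E := expR _; ring.
Qed.

Definition deriv_gaussian_monomial k x : R :=
  k%:R * gaussian_monomial k.-1 x - pi *+ 2 * gaussian_monomial k.+1 x.

Lemma integral_deriv_gaussian_monomial_itv k n :
  (\int[mu]_(x in `[(- n.+1%:R)%R, n.+1%:R%R]) (deriv_gaussian_monomial k x)%:E =
   (gaussian_monomial k n.+1%:R - gaussian_monomial k (- n.+1%:R))%:E)%E.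
Proof.
have D x := is_derive_gaussian_monomial k x.
rewrite EFinB; apply: continuous_FTC2.
- by rewrite (@lt_trans _ _ 0)// ?oppr_lt0 ltr0n.
- apply: continuous_subspaceT => x; apply: cvgB; apply: cvgM; try exact: cvg_cst.
    exact: continuous_gaussian_monomial.
  exact: continuous_gaussian_monomial.
- split; first by move=> x _; exact: ex_derive.
    by apply: cvg_at_right_filter; exact: continuous_gaussian_monomial.
  by apply: cvg_at_left_filter; exact: continuous_gaussian_monomial.
- by move=> x _; rewrite derive1E derive_val.
Qed.

Lemma cvg_integral_symmetric_itv (f : R -> R) : mu.-integrable setT (EFin \o f) ->
  ((fun n => \int[mu]_(x in `[(- n.+1%:R)%R, n.+1%:R%R]) (f x)%:E) @ \oo -->
   \int[mu]_x (f x)%:E)%E.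
Proof.
move=> intf; pose D n : set R := [set` `[(- n.+1%:R)%R, n.+1%:R%R]].
have mf := measurable_int _ intf.
under eq_fun do rewrite integral_mkcond.
have [] := @dominated_convergence _ _ _ mu setT measurableT
  (fun n => (EFin \o f) \_ (D n)) (EFin \o f) (fun x => `|(f x)%:E|%E).
- move=> n; apply/(measurable_restrictT _ _).1; first exact: measurable_itv.
  exact: measurable_funTS mf.
- by [].
- apply: nearW => x _; apply: cvg_near_cst.
  near=> n; rewrite patchE mem_set// /D/= in_itv/= -ler_norml.
  rewrite (@le_trans _ _ n%:R) ?ler_nat//.
  near: n; exact: nbhs_infty_ger.
- exact: integrable_abse.
- apply: nearW => x n _; rewrite patchE; case: ifP => // _.
  by rewrite abse0 abse_ge0.
- by move=> _ _.
Unshelve. all: by end_near. Qed.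

Lemma cvg_gaussian_monomial_seq k (s : R) : `|s| = 1 ->
  gaussian_monomial k (s * n.+1%:R) @[n --> \oo] --> 0.
Proof.
move=> s1; have [C HC] := gaussian_monomial_le k.+1.
apply: norm_cvg0; apply: (@squeeze_cvgr _ _ _ _ (fun=> 0) (fun n => `|C| * harmonic n)).
- near=> n; rewrite normr_ge0/= /harmonic/= ler_pdivlMr//.
  have <- : `|gaussian_monomial k.+1 (s * n.+1%:R)| =
            `|gaussian_monomial k (s * n.+1%:R)| * n.+1%:R.
    rewrite (_ : gaussian_monomial k.+1 _ = s * n.+1%:R * gaussian_monomial k (s * n.+1%:R)).
      by rewrite normrM [in LHS]normrM s1 mul1r normr_nat mulrC.
    by rewrite /gaussian_monomial exprS mulrA.
  rewrite (le_trans (HC _))// (le_trans (ler_norm _))// normrM ler_piMr//.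
  rewrite ger0_norm ?expR_ge0// -expR0 ler_expR oppr_le0.
  by rewrite mulr_ge0 ?sqr_ge0// divr_ge0 ?pi_ge0.
- exact: cvg_cst.
- rewrite -[X in _ --> X](mulr0 `|C|); apply: cvgM; first exact: cvg_cst.
  exact: cvg_harmonic.
Unshelve. all: by end_near. Qed.

Definition gaussian_integral k : R := fine (\int[mu]_x (gaussian_monomial k x)%:E).

Lemma gaussian_integralE k :
  (\int[mu]_x (gaussian_monomial k x)%:E = (gaussian_integral k)%:E)%E.
Proof.
by rewrite fineK//; exact: (integrable_fin_num measurableT (integrable_gaussian_monomial k)).
Qed.

(** The two sides differ by the integral of the derivative of
    [gaussian_monomial k], which is the limit of its increments from
    [-n] to [n]. For [k = 0] this says that the mean vanishes. *)
Lemma gaussian_integral_rec k :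
  k%:R * gaussian_integral k.-1 = pi *+ 2 * gaussian_integral k.+1.
Proof.
have i1 := integrableZl measurableT k%:R (integrable_gaussian_monomial k.-1).
have i2 := integrableZl measurableT (pi *+ 2) (integrable_gaussian_monomial k.+1).
have iD : mu.-integrable setT (EFin \o deriv_gaussian_monomial k).
  by have := integrableB measurableT i1 i2; apply: eq_integrable.
have := cvg_integral_symmetric_itv iD.
under eq_fun do rewrite integral_deriv_gaussian_monomial_itv.
move=> cD.
have c0 : (gaussian_monomial k n.+1%:R - gaussian_monomial k (- n.+1%:R)) @[n --> \oo] --> (0 : R).
  rewrite -[X in _ --> X](subr0 0); apply: cvgB.
    have := @cvg_gaussian_monomial_seq k 1 (normr1 _).
    by under eq_fun do rewrite mul1r.
  have := @cvg_gaussian_monomial_seq k (-1) (normrN1 _).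
  by under eq_fun do rewrite mulN1r.
have : ((gaussian_monomial k n.+1%:R -
    gaussian_monomial k (- n.+1%:R))%:E @[n --> \oo] --> (0%:E : \bar R)).
  by apply: cvg_EFin c0; apply: nearW.
move=> /(cvg_unique (@ereal_hausdorff R) cD).
rewrite (_ : (fun x => _) = (fun x => (k%:R)%:E * (EFin \o gaussian_monomial k.-1) x -
    (pi *+ 2)%:E * (EFin \o gaussian_monomial k.+1) x)%E); last exact/funext.
rewrite integralB// !integralZl//; try exact: integrable_gaussian_monomial.
rewrite !gaussian_integralE -!EFinM -EFinB => -[] /eqP.
by rewrite subr_eq0 => /eqP.
Qed.

Lemma gaussian_integral_moment k :
  gaussian_integral k = gaussian_moment (pi *+ 2)^-1 k.
Proof.
have p0 : (pi : R) *+ 2 != 0 by rewrite mulrn_eq0/= gt_eqF ?pi_gt0.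
suff : gaussian_integral k = gaussian_moment (pi *+ 2)^-1 k /\
  gaussian_integral k.+1 = gaussian_moment (pi *+ 2)^-1 k.+1 by case.
elim: k => [|k [IH1 IH2]].
  split.
    rewrite /gaussian_integral; under eq_integral do rewrite /gaussian_monomial mul1r.
    by rewrite integral_gaussian1.
  have := gaussian_integral_rec 0; rewrite mul0r => /esym/eqP.
  by rewrite mulf_eq0 (negPf p0)/= => /eqP.
split=> //; have := gaussian_integral_rec k.+1; rewrite /= IH1 => E.
by apply: (mulfI p0); rewrite -E !mulrA mulfV// mul1r.
Qed.

Lemma integral_gaussian_monomial k : (\int[mu]_x (gaussian_monomial k x)%:E =
  (gaussian_moment (pi *+ 2)^-1 k)%:E)%E.
Proof. by rewrite gaussian_integralE gaussian_integral_moment. Qed.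

End moments.

(** * Gaussian moments in dimension d *)

Section product_integral.
Local Open Scope classical_set_scope.
Local Open Scope ring_scope.
Context d1 d2 (T1 : measurableType d1) (T2 : measurableType d2) (R : realType).
Variables (m1 : {sigma_finite_measure set T1 -> \bar R})
  (m2 : {sigma_finite_measure set T2 -> \bar R}).

Lemma integral_product_mul (f : T1 -> R) (g : T2 -> R) (a b : R) :
  m1.-integrable setT (EFin \o f) -> m2.-integrable setT (EFin \o g) ->
  (\int[m1]_x (f x)%:E = a%:E)%E -> (\int[m2]_y (g y)%:E = b%:E)%E ->
  (m1 \x m2)%E.-integrable setT (fun z => (f z.1 * g z.2)%:E) /\
  (\int[m1 \x m2]_z (f z.1 * g z.2)%:E = (a * b)%:E)%E.
Proof.
move=> intf intg fa gb.
have mf : measurable_fun setT f by apply/measurable_EFinP; exact: measurable_int intf.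
have mg : measurable_fun setT g by apply/measurable_EFinP; exact: measurable_int intg.
have mfg : measurable_fun setT (fun z : T1 * T2 => (f z.1 * g z.2)%:E).
  apply/measurable_EFinP; apply: measurable_funM; apply: measurableT_comp => //.
have intfg : (m1 \x m2)%E.-integrable setT (fun z => (f z.1 * g z.2)%:E).
  apply/integrable12ltyP => //=.
  have -> : (fun x => \int[m2]_y (`|f x * g y|)%:E)%E =
      (fun x => `|(f x)%:E| * \int[m2]_y (`|(g y)%:E|))%E.
    apply/funext => x; under eq_integral do rewrite normrM EFinM.
    rewrite ge0_integralZl//=.
    by apply/measurable_EFinP; exact: measurableT_comp.
  rewrite ge0_integralZr//=.
  - apply: lte_mul_pinfty; first exact: integral_ge0.
      by move: intf => /integrableP[]; rewrite ge0_fin_numE ?integral_ge0.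
    by move: intg => /integrableP[].
  - by apply/measurable_EFinP; exact: measurableT_comp.
  - exact: integral_ge0.
split=> //; rewrite -(integral12_prod_meas1 intfg) /fubini_F/=.
under eq_integral => x _.
  under eq_integral do rewrite EFinM.
  rewrite integralZl//= gb.
  over.
by rewrite integralZr//= fa EFinM.
Qed.
End product_integral.

Section tuple_integral.
Local Open Scope classical_set_scope.
Local Open Scope ring_scope.
Variable R : realType.
Notation mu := (@lebesgue_measure R).

(** Independence of the coordinates, by Fubini's theorem along the recursive
    definition of [lebesgue_tuple]. *)
Lemma integral_tuple_prod d (h : 'I_d -> R -> R) (c : 'I_d -> R) :
  (forall i, mu.-integrable setT (EFin \o h i)) ->
  (forall i, \int[mu]_x (h i x)%:E = (c i)%:E)%E ->
  (@lebesgue_tuple R d).-integrable setT (fun x => (\prod_i h i (tnth x i))%:E) /\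
  (\int[@lebesgue_tuple R d]_x (\prod_i h i (tnth x i))%:E = (\prod_i c i)%:E)%E.
Proof.
elim: d => [|d IH] in h c * => ih ch.
  rewrite big_ord0 (_ : (fun x => _) = cst 1%E).
    split; last by rewrite integral_cst//= diracT mule1.
    exact: finite_measure_integrable_cst.
  by apply/funext => x; rewrite big_ord0.
have mh i : measurable_fun setT (h i).
  by apply/measurable_EFinP; exact: measurable_int (ih i).
have [iH cH] := IH (fun i => h (lift ord0 i)) (fun i => c (lift ord0 i))
  (fun i => ih _) (fun i => ch _).
have mf : measurable_fun setT (fun x : d.+1.-tuple R => (\prod_i h i (tnth x i))%:E).
  apply/measurable_EFinP; apply: measurable_prod => i _.
  by apply: measurableT_comp => //; exact: measurable_tnth.
have [ifc cfc] := integral_product_mul (ih ord0) iH (ch ord0) cH.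
have E : (fun x : d.+1.-tuple R => (\prod_i h i (tnth x i))%:E) \o @cons_pair R d =
    (fun z => (h ord0 z.1 * \prod_i h (lift ord0 i) (tnth z.2 i))%:E).
  apply/funext => z /=; rewrite big_ord_recl tnth0; congr (_ * _)%:E.
  by apply: eq_bigr => i _; rewrite tnthS.
rewrite -E in ifc.
split.
  exact: (integrable_pushforward (@measurable_cons_pair R d) mf ifc).
rewrite big_ord_recl -cfc.
rewrite [LHS](integral_pushforward (@measurable_cons_pair R d) mf ifc)//.
by rewrite E.
Qed.
End tuple_integral.

Section density.
Local Open Scope classical_set_scope.
Local Open Scope ring_scope.
Variables (R : realType) (d : nat).
Notation rho := (@gaussian_measure R d).
Notation lam := (@lebesgue_tuple R d).

Let mgauss : measurable_fun setT (fun x : d.-tuple R => (gaussian_fun x)%:E).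
Proof. by apply/measurable_EFinP; exact: measurable_gaussian_fun. Qed.

Lemma gaussian_measure_dominates : rho `<< lam.
Proof.
apply/null_content_dominatesP => A mA A0.
by apply: null_set_integral => //; exact: measurable_funTS mgauss.
Qed.

(** The Radon-Nikodym derivative of the Gaussian measure is almost everywhere
    [gaussian_fun], since both have the same integrals. *)
Lemma ge0_integral_gaussian_measure (f : d.-tuple R -> \bar R) :
  (forall x, 0 <= f x)%E -> measurable_fun setT f ->
  (\int[rho]_x f x = \int[lam]_x (f x * (gaussian_fun x)%:E))%E.
Proof.
move=> f0 mf; have dom := gaussian_measure_dominates.
have intD := Radon_Nikodym_SigmaFinite.f_integrable dom.
have mD := measurable_int _ intD.
rewrite -(Radon_Nikodym_SigmaFinite.change_of_variables dom f0 measurableT mf).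
apply: ae_eq_integral => //; try exact: emeasurable_funM.
apply: ae_eqe_mul2l; apply: integral_ae_eq => // E _ mE.
by rewrite -(Radon_Nikodym_SigmaFinite.f_integral dom mE).
Qed.

Lemma integral_gaussian_measure (f : d.-tuple R -> R) : measurable_fun setT f ->
  lam.-integrable setT (fun x => (f x * gaussian_fun x)%:E) ->
  (rho.-integrable setT (EFin \o f)) /\
  (\int[rho]_x (f x)%:E = \int[lam]_x (f x * gaussian_fun x)%:E)%E.
Proof.
move=> mf intf; have mEf : measurable_fun setT (EFin \o f) by apply/measurable_EFinP.
split.
  apply/integrableP; split => //.
  rewrite ge0_integral_gaussian_measure//; last exact: measurableT_comp.
  move/integrableP: intf => [_]; apply: le_lt_trans.
  rewrite le_eqVlt; apply/orP; left; apply/eqP; apply: eq_integral => x _ /=.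
  by rewrite normrM (ger0_norm (gaussian_fun_ge0 x)).
rewrite [LHS]integralE [RHS]integralE.
rewrite !ge0_integral_gaussian_measure//; last 2 first.
  exact: measurable_funeneg.
  exact: measurable_funepos.
congr (_ - _)%E; apply: eq_integral => x _.
  rewrite !funeposE -!EFin_max -EFinM; congr EFin.
  by rewrite maxr_pMl ?gaussian_fun_ge0// mul0r.
rewrite !funenegE -!EFin_max -EFinM; congr EFin.
by rewrite maxr_pMl ?gaussian_fun_ge0// mul0r mulNr.
Qed.

Lemma integral_gaussian_measure_monomial (m : 'I_d -> nat) :
  rho.-integrable setT (fun x => (\prod_i tnth x i ^+ m i)%:E) /\
  (\int[rho]_x (\prod_i tnth x i ^+ m i)%:E =
   (\prod_i gaussian_moment (pi *+ 2)^-1 (m i))%:E)%E.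
Proof.
have [intm Em] := integral_tuple_prod
  (fun i => integrable_gaussian_monomial R (m i)) (fun i => integral_gaussian_monomial R (m i)).
have E (x : d.-tuple R) : \prod_i gaussian_monomial (m i) (tnth x i) =
    (\prod_i tnth x i ^+ m i) * gaussian_fun x.
  rewrite /gaussian_monomial big_split/=; congr (_ * _).
  by rewrite -expR_sum /gaussian_fun mulr_sumr sumrN.
rewrite -Em; under [in RHS]eq_integral do rewrite E.
apply: integral_gaussian_measure.
  apply: measurable_prod => i _; apply: measurable_funX; exact: measurable_tnth.
by move: intm; apply: eq_integrable => // x _; rewrite E.
Qed.

Lemma integral_gaussian_measure_mpoly (f : mpoly d R) :
  (\int[rho]_x (meval (tnth x) f)%:E =
   (\sum_(m <- msupp f) mcoeff m f * \prod_i gaussian_moment (pi *+ 2)^-1 (m i))%:E)%E.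
Proof.
under eq_integral do rewrite mevalE -sumEFin.
rewrite integral_sum//; last first.
  move=> m; under eq_fun do rewrite EFinM.
  apply: integrableZl => //; exact: (integral_gaussian_measure_monomial m).1.
rewrite -sumEFin; apply: eq_bigr => m _.
under eq_integral do rewrite EFinM.
rewrite integralZl//; last exact: (integral_gaussian_measure_monomial m).1.
by rewrite (integral_gaussian_measure_monomial m).2.
Qed.
End density.

(** * Designs from codes *)

Lemma exists_labelling (R : realType) (F : finType) (s : seq R) : uniq s -> size s = #|F| ->
  exists2 phi : F -> R, injective phi &
    forall k, \sum_x phi x ^+ k = seq_power_sum s k.
Proof.
move=> us ss; exists (fun x => nth 0 s (enum_rank x)).
  move=> x y /eqP; rewrite nth_uniq ?ss ?ltn_ord// => /eqP/val_inj.
  exact: enum_rank_inj.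
move=> k; rewrite /seq_power_sum (big_nth 0) big_mkord ss.
rewrite (reindex (@enum_rank F))//=.
by apply: onW_bij; exact: enum_rank_bij.
Qed.

(** A monomial of degree at most [t] involves at most [t] coordinates, so both
    its Gaussian integral and its average over the words of [U] factor into
    contributions of single coordinates; these agree by the choice of [phi]. The
    injectivity of [phi] makes distinct words give distinct points. *)
Lemma code_design (R : realType) (F : finFieldType) (t d : nat) (phi : F -> R)
    (U : {set 'cV[F]_d}) : injective phi ->
  (forall k, (k <= t)%N -> (\sum_x phi x ^+ k) / #|F|%:R = gaussian_moment (pi *+ 2)^-1 k) ->
  0 \in U ->
  (forall u v a, u \in U -> v \in U -> u + a *: v \in U) ->
  (forall (T : {set 'I_d}) i, (#|T| <= t)%N -> i \in T ->
      exists2 v, v \in U & v i 0 = 1 /\ forall j, j \in T -> j != i -> v j 0 = 0) ->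
  exists X : {fset d.-tuple R}, gaussian_design t X /\ #|` X| = #|U|.
Proof.
move=> phi_inj phiE U0 closedU dualU.
pose pt (u : 'cV[F]_d) : d.-tuple R := [tuple phi (u i 0) | i < d].
have pt_inj : injective pt.
  move=> u v uv; apply/colP => i; apply: phi_inj.
  by have := congr1 (fun x => tnth x i) uv; rewrite !tnth_mktuple.
pose X : {fset d.-tuple R} := [fset x in [seq pt u | u <- enum U]]%fset.
have permX : perm_eq (enum_fset X) [seq pt u | u <- enum U].
  apply: uniq_perm; first exact: fset_uniq.
    by rewrite map_inj_uniq ?enum_uniq.
  by move=> x; rewrite inE.
have cardX : #|` X| = #|U| by rewrite (perm_size permX) size_map cardE.
exists X; split=> //; split.
  by rewrite -cardfs_gt0 cardX card_gt0; apply/set0Pn; exists 0.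
move=> f sf; rewrite integral_gaussian_measure_mpoly; congr EFin.
have cU : #|U|%:R != 0 :> R.
  by rewrite pnatr_eq0 -lt0n card_gt0; apply/set0Pn; exists 0.
apply: (mulfI cU); rewrite cardX mulVKf//.
rewrite (perm_big _ permX) [in RHS]big_map [in RHS]big_enum/=.
under [RHS]eq_bigr do rewrite mevalE.
rewrite exchange_big/= mulr_sumr [LHS]big_seq [RHS]big_seq; apply: eq_bigr => m mf.
rewrite -mulr_sumr mulrCA; congr (_ * _).
have mt : (mdeg m <= t)%N by rewrite -ltnS (leq_trans _ sf)// mmeasure_mnm_lt.
have mi i : (m i <= t)%N.
  by rewrite (leq_trans _ mt)// mdegE (bigD1 i)//= leq_addr.
pose T := [set i | m i != 0%N].
have Tt : (#|T| <= t)%N.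
  rewrite (leq_trans _ mt)// mdegE -sum1_card big_mkcond leq_sum// => i _.
  by rewrite inE; case: (m i).
have supp (g : 'I_d -> R) : (forall i, m i = 0%N -> g i = 1) ->
    \prod_i g i = \prod_(i in T) g i.
  move=> g1; rewrite [RHS]big_mkcond; apply: eq_bigr => i _.
  by rewrite inE; case: eqP => // /g1.
under [RHS]eq_bigr => u _.
  under eq_bigr do rewrite tnth_mktuple.
  rewrite supp; last by move=> i ->.
  over.
have qR : #|F|%:R != 0 :> R.
  by rewrite pnatr_eq0 -lt0n; apply/card_gt0P; exists 0.
rewrite (code_average qR closedU dualU (fun i x => phi x ^+ m i) Tt).
congr (_ * _); rewrite supp; last by move=> i ->.
by apply: eq_bigr => i _; rewrite phiE.
Qed.

Theorem theorem1 (R : realType) (t : nat) (t_gt0 : (0 < t)%N) :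
  exists C : R, forall d : nat, (1 <= d)%N ->
    exists X : {fset d.-tuple R},
      gaussian_design t X /\ #|` X|%:R <= C * d%:R ^+ (t - 1).
Proof.
have v0 : 0 < (pi *+ 2)^-1 :> R by rewrite invr_gt0 pmulrn_lgt0 ?pi_gt0.
have [n0 Hn0] := equal_weight_design t v0.
have [p n0p pr_p] := prime_above n0.
have [s [us ss sE]] := Hn0 p (ltnW n0p).
exists (p%:R ^+ t) => d d0.
have cardF : #|'F_p| = p := card_Fp pr_p.
have [phi phi_inj phiE] := exists_labelling us (etrans ss (esym cardF)).
have [U [cardU U0 closedU dualU]] := @exists_code 'F_p t.-1 d d0.
rewrite prednK// in dualU.
have [|X [designX cardX]] := @code_design R 'F_p t d phi U phi_inj _ U0 closedU dualU.
  move=> k kt; rewrite phiE sE// cardF -(mulr_natr (gaussian_moment _ _)) mulfK// pnatr_eq0.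
  by rewrite -lt0n prime_gt0.
exists X; split=> //; rewrite cardX -natrX -natrX -natrM ler_nat (leq_trans cardU)//.
by rewrite cardF subn1 expnMn mulnCA -expnS prednK// mulnC.
Qed.
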